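(* For every positive integer $k$ there is a real constant $\mathcal{F}_k>0$ such that, as $n\to\infty$, $$\prod_{\nu=1}^n (k\nu)! \;\sim\; \mathcal{F}_k\,\mathcal{A}^k\,(2\pi)^{\frac14}\left(\frac{k\,n}{e^{3/2}}\right)^{\frac{k}{2}n(n+1)}\left(2\pi k e^{k/2-1}\,n\right)^{\frac n2} n^{\frac14+\frac{k}{12}+\frac1{12k}},$$ and these constants satisfy $$\log\mathcal{F}_k=\frac{\gamma}{12k}+\sum_{j\ge2}{}'\,\frac{B_{2j}\,\zeta(2j-1)}{2j(2j-1)\,k^{2j-1}}.$$ Moreover, $$\lim_{k\to\infty}\mathcal{F}_k=1,\qquad \lim_{k\to\infty}\mathcal{F}_k^{\,k}=e^{\gamma/12},$$ and there is a constant $\mathcal{F}_\infty>0$ such that $$\prod_{k=1}^n\mathcal{F}_k\;\sim\;\mathcal{F}_\infty\,n^{\gamma/12}\quad\text{as } n\to\infty,$$ with $$\log\mathcal{F}_\infty=\frac{\gamma^2}{12}+\sum_{j\ge2}{}'\,\frac{B_{2j}\,\zeta(2j-1)^2}{2j(2j-1)}.$$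
   Context: $f\sim g$ means $f/g\to1$. $B_m$ are the Bernoulli numbers, $z/(e^z-1)=\sum_{m\ge0}B_mz^m/m!$; $\zeta$ is the Riemann zeta function; $\gamma$ is Euler's constant. $\mathcal{A}$ is the Glaisher--Kinkelin constant, $\log\mathcal{A}=\frac1{12}-\zeta'(-1)$. Notation $\sum'$ (divergent series with remainder): $f(x)=\sum_{j\ge j_0}'f_j(x)$ means that there is a constant $N$ (depending on $f$) such that for all $m\ge N$ and all $x$ in the domain there is $\theta_m(x)\in(0,1)$ with $$f(x)=\sum_{j=j_0}^{m-1}f_j(x)+\theta_m(x)f_m(x).$$ In the formula for $\log\mathcal{F}_k$ the variable is $k$ (a positive integer), i.e. the equality means $\log\mathcal{F}_k-\frac{\gamma}{12k}=\sum_{j=2}^{m-1}\frac{B_{2j}\zeta(2j-1)}{2j(2j-1)k^{2j-1}}+\theta_m(k)\frac{B_{2m}\zeta(2m-1)}{2m(2m-1)k^{2m-1}}$; in the formula for $\log\mathcal{F}_\infty$ there is no variable (constant function). *)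

(* Defs.v *)
From Stdlib Require Export Reals Factorial.
From Coquelicot Require Export Coquelicot.
Open Scope R_scope.

Definition asymp_equiv (f g : nat -> R) : Prop :=
  is_lim_seq (fun n => f n / g n) 1.

(* [prod_from1 f n] is f 1 * ... * f n; Stdlib's [prod_f_R0] starts at index 0. *)
Fixpoint prod_from1 (f : nat -> R) (n : nat) : R :=
  match n with
  | O => 1
  | S m => prod_from1 f m * f (S m)
  end.

(* The divergent series with remainder f(x) = sum'_{j >= j0} fj_j(x), x in D.
   [sum_n_m _ j0 (m - 1)] sums over j0 <= j <= m - 1 and is 0 if m <= j0
   (as soon as m > 0).  The bound N is uniform in x. *)
Definition divergent_series {X : Type} (D : X -> Prop) (f : X -> R)
    (j0 : nat) (fj : nat -> X -> R) : Prop :=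
  exists N : nat, forall m : nat, (N <= m)%nat -> forall x : X, D x ->
    exists theta : R, 0 < theta < 1 /\
      f x = sum_n_m (fun j => fj j x) j0 (m - 1) + theta * fj m x.

(* z / (e^z - 1) = sum_m B_m z^m / m! near 0.  The point z = 0, where Rocq's
   quotient is not the continuous extension, is excluded; this still
   determines B. *)
Definition is_bernoulli_numbers (B : nat -> R) : Prop :=
  exists r : R, 0 < r /\ forall z : R, z <> 0 -> Rabs z < r ->
    is_pseries (fun m => B m / INR (fact m)) z (z / (exp z - 1)).

Definition Cexp (z : C) : C :=
  (exp (Re z) * cos (Im z), exp (Re z) * sin (Im z)).

Definition analytic_at (f : C -> C) (s0 : C) : Prop :=
  exists (a : nat -> C) (r : R), 0 < r /\
    forall s : C, Cmod (s - s0)%C < r ->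
      is_pseries (K := C_AbsRing) (V := C_NormedModule) a (s - s0)%C (f s).

(* The Riemann zeta function: the analytic continuation to C \ {1} of the
   Dirichlet series sum_{n >= 1} n^{-s}, Re s > 1.  By the identity theorem
   this determines zeta on C \ {1}; the value at the pole is unconstrained. *)
Definition is_riemann_zeta (zeta : C -> C) : Prop :=
  (forall s : C, 1 < Re s ->
     is_series (K := C_AbsRing) (V := C_NormedModule)
       (fun n => Cexp (- s * RtoC (ln (INR (S n))))%C) (zeta s)) /\
  (forall s : C, s <> RtoC 1 -> analytic_at zeta s).

(* log A = 1/12 - zeta'(-1), where zeta'(-1) is real. *)
Definition glaisher (zeta : C -> C) : R :=
  exp (1 / 12 - Re (C_derive zeta (RtoC (-1)))).

Definition euler_gamma : R :=
  real (Lim_seq (fun n => sum_n_m (fun i => / INR i) 1 n - ln (INR n))).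

(* zeta(2j - 1), a real number for j >= 2. *)
Definition zeta_odd (zeta : C -> C) (j : nat) : R :=
  Re (zeta (RtoC (2 * INR j - 1))).

(* Main.v *)
Require Import Defs.
From Stdlib Require Import Reals Factorial Lra Lia.
From Coquelicot Require Import Coquelicot.
Open Scope R_scope.

(** Let [mu(n)] be the error of Stirling's formula,
    [ln n! = (n + 1/2) ln n - n + ln(2 PI)/2 + mu(n)].  Summing it over the
    multiples [k, 2k, ..., nk] splits the logarithm of [k! (2k)! ... (nk)!]
    into explicit terms, [k] times the sum of [v ln v] (which produces
    Glaisher's constant), half of [ln n!] (which produces [(2 PI)^(1/4)]),
    a harmonic sum coming from the leading term [1/(12 n)] of [mu] (which
    produces Euler's constant), and the sum of [mu(kv) - 1/(12kv)], which
    converges.  Hence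
    [ln F_k = gamma/(12k) + sum_v (mu(kv) - 1/(12kv))].
    The same computation one level up, with one more harmonic sum, gives
    [ln F_oo = gamma^2/12 + sum_k sum_v (mu(kv) - 1/(12kv))].

    The expansions with remainder rest on one property of Stirling's series:
    it envelops [mu], that is, the remainders after consecutive terms have
    opposite strict signs ([binet_envelope]), which is the same as saying that
    each remainder is a fraction [theta] in (0,1) of the first omitted term
    ([enveloped_remainder]).  A sum of numbers of one sign keeps that sign, so
    enveloping passes to convergent sums ([enveloped_Series]); summing
    [(kv)^(1-2j)] over [v], and then over [k], puts [zeta(2j-1)], and then its
    square, into the coefficients.  The limits of [F_k] and [F_k^k] follow from
    the first two signs alone.

    The enveloping property is telescoped: [mu(n)] minus a partial sum tends
    to 0, so its sign can be read off from its increments.  These are single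
    Euler-Maclaurin steps for the logarithm on an interval of length one, whose
    sign is known because an even Bernoulli polynomial minus its value at 0 has
    a constant sign on (0,1) ([bpoly_even_sign], [em_step_sign]).

    Identifying Glaisher's constant with [exp(1/12 - zeta'(-1))] is the
    analytic part, since zeta is known only as some analytic continuation.
    Euler's transformation turns [(1 - 2^(1-s)) zeta(s)], the alternating sum
    of [n^(-s)], into finitely many explicit terms plus an absolutely convergent
    series of third differences that makes sense for [Re s > -2] ([alt_sum]).
    Along a horizontal line off the real axis both sides are real-analytic, and
    they agree to the right of 1, hence everywhere ([eta_off_axis]); letting the
    line approach the real axis reaches [-1] without crossing the pole
    ([eta_on_axis]).  The regularised sum may be differentiated termwise, which
    expresses [zeta'(-1)] through the regularised alternating sum of [n ln n],
    and this one is 3 times Glaisher's limit up to a multiple of [ln 2]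
    ([alt_sum_neg_t_ln], [zeta_derive_minus_1]). *)

(** * Real analysis *)

(** Sums produce equations over the carrier of an abstract monoid; [ring] and
    [field] need to see them at [R]. *)
Ltac eqR := match goal with |- @eq _ ?a ?b => change (@eq R a b) end.

Lemma sum_n_succ (a : nat -> R) (n : nat) : sum_n a (S n) = sum_n a n + a (S n).
Proof. exact (sum_Sn a n). Qed.

Lemma sum_n_m_Rminus (a b : nat -> R) (n m : nat) :
  sum_n_m (fun k => a k - b k) n m = sum_n_m a n m - sum_n_m b n m.
Proof.
rewrite (sum_n_m_ext _ (fun k => plus (a k) (mult (K := R_Ring) (-1) (b k)))).
- rewrite sum_n_m_plus, (sum_n_m_mult_l (K := R_Ring) (-1) b).
  change (@eq R (sum_n_m a n m + -1 * sum_n_m b n m)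
    (sum_n_m a n m - sum_n_m b n m)).
  ring.
- intros k. unfold plus, mult; simpl; ring.
Qed.

Lemma is_series_Rplus (a b : nat -> R) (la lb : R) :
  is_series a la -> is_series b lb -> is_series (fun n => a n + b n) (la + lb).
Proof. exact (is_series_plus a b la lb). Qed.

Lemma is_series_Rmult (c : R) (a : nat -> R) (l : R) :
  is_series a l -> is_series (fun n => c * a n) (c * l).
Proof. exact (is_series_scal_l c a l). Qed.

Lemma is_series_null : is_series (fun _ : nat => 0) 0.
Proof.
change (is_lim_seq (sum_n (fun _ : nat => 0)) 0).
apply is_lim_seq_ext with (fun _ => 0); [|apply is_lim_seq_const].
intros n. eqR. rewrite sum_n_const. ring.
Qed.

Lemma Series_pos (a : nat -> R) : ex_series a -> (forall n, 0 < a n) -> 0 < Series a.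
Proof.
intros Ha Hp. rewrite Series_incr_1 by exact Ha.
assert (0 <= Series (fun k => a (S k))).
{ rewrite <- (is_series_unique _ _ is_series_null). apply Series_le.
  - intros n; specialize (Hp (S n)); lra.
  - now apply (ex_series_incr_1 a). }
specialize (Hp 0%nat). lra.
Qed.

Lemma is_lim_seq_inv_infty (u : nat -> R) :
  is_lim_seq u p_infty -> is_lim_seq (fun n => / u n) 0.
Proof.
intros H. apply (is_lim_seq_inv u p_infty); [exact H|discriminate].
Qed.

Lemma is_lim_seq_exp (u : nat -> R) (l : R) :
  is_lim_seq u l -> is_lim_seq (fun n => exp (u n)) (exp l).
Proof.
apply is_lim_seq_continuous, derivable_continuous_pt, derivable_pt_exp.
Qed.

Lemma continuous_of_ex_derive (f : R -> R) (x : R) :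
  ex_derive f x -> continuous f x.
Proof. exact (ex_derive_continuous f x). Qed.

Lemma is_derive_sum_f_R0 (f f' : nat -> R -> R) (n : nat) (t : R) :
  (forall k, (k <= n)%nat -> is_derive (f k) t (f' k t)) ->
  is_derive (fun u => sum_f_R0 (fun k => f k u) n) t
    (sum_f_R0 (fun k => f' k t) n).
Proof.
induction n as [|n IH]; intros H; simpl.
- apply H; lia.
- apply @is_derive_plus; [apply IH; intros; apply H; lia|apply H; lia].
Qed.

Lemma MVT_is_derive (f f' : R -> R) (a b : R) :
  a < b -> (forall t, a <= t <= b -> is_derive f t (f' t)) ->
  exists c, a < c < b /\ f b - f a = f' c * (b - a).
Proof.
intros Hab H. destruct (MVT_cor2 f f' a b Hab) as [c [E Hc]].
- intros c Hc. now apply is_derive_Reals, H.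
- now exists c.
Qed.

(** The symmetries of Bernoulli polynomials are identities between functions with
    the same derivative; this is how they are integrated. *)
Lemma affine_of_const_derive (f : R -> R) (c : R) :
  (forall t, is_derive f t c) -> forall t, f t = f 0 + c * t.
Proof.
intros H t. destruct (Rtotal_order t 0) as [Ht|[->|Ht]]; [|ring|].
- destruct (MVT_is_derive f (fun _ => c) t 0 Ht ltac:(auto)) as [_ [_ E]]. lra.
- destruct (MVT_is_derive f (fun _ => c) 0 t Ht ltac:(auto)) as [_ [_ E]]. lra.
Qed.

Lemma increasing_of_derive (f f' : R -> R) (a b : R) :
  (forall t, a <= t <= b -> is_derive f t (f' t)) ->
  (forall t, a < t < b -> 0 < f' t) ->
  forall u v, a <= u -> u < v -> v <= b -> f u < f v.
Proof.
intros Hd Hp u v Hu Huv Hv.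
destruct (MVT_is_derive f f' u v Huv) as [c [Hc E]].
- intros t Ht; apply Hd; lra.
- specialize (Hp c ltac:(lra)). nra.
Qed.

(** A strictly convex function with two zeros is negative between them: its
    slopes to the left and right of a nonnegative value would contradict the
    monotonicity of its derivative. *)
Lemma convex_neg (f f1 f2 : R -> R) (a b : R) :
  (forall t, a <= t <= b -> is_derive f t (f1 t)) ->
  (forall t, a <= t <= b -> is_derive f1 t (f2 t)) ->
  (forall t, a < t < b -> 0 < f2 t) ->
  f a = 0 -> f b = 0 -> forall t, a < t < b -> f t < 0.
Proof.
intros H1 H2 Hp Ha Hb t Ht.
pose proof (increasing_of_derive f1 f2 a b H2 Hp) as Hi.
destruct (MVT_is_derive f f1 a t) as [c [Hc Ec]]; [lra|intros; apply H1; lra|].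
destruct (MVT_is_derive f f1 t b) as [d [Hd Ed]]; [lra|intros; apply H1; lra|].
specialize (Hi c d ltac:(lra) ltac:(lra) ltac:(lra)).
rewrite Ha in Ec. rewrite Hb in Ed.
destruct (Rlt_or_le (f t) 0) as [|Hf]; [assumption|exfalso].
assert (0 <= f1 c) by (apply Rmult_le_reg_r with (t - a); lra).
assert (f1 d <= 0) by (apply Rmult_le_reg_r with (b - t); lra).
lra.
Qed.

Lemma ln_ge_0 (t : R) : 1 <= t -> 0 <= ln t.
Proof. intros Ht. rewrite <- ln_1. apply ln_le; lra. Qed.

Lemma ln_le_sub_1 (x : R) : 0 < x -> ln x <= x - 1.
Proof.
intros Hx. destruct (Req_dec x 1) as [->|Hn]; [rewrite ln_1; lra|].
apply Rlt_le, exp_lt_inv. rewrite exp_ln by exact Hx.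
pose proof (exp_ineq1 (x - 1) ltac:(lra)). lra.
Qed.

Lemma exp_pow_INR (x : R) (k : nat) : exp x ^ k = exp (INR k * x).
Proof.
rewrite <- Rpower_pow by apply exp_pos. unfold Rpower. now rewrite ln_exp.
Qed.

(** * Real power series and real-analytic functions *)

Lemma is_pseries_R_iff (a : nat -> R) (x l : R) :
  is_pseries a x l <-> is_series (fun n => a n * x ^ n) l.
Proof.
assert (E : forall n, scal (pow_n (K := R_AbsRing) x n) (a n) = a n * x ^ n).
{ intros n. etransitivity; [apply Rmult_comm|]. f_equal; apply pow_n_pow. }
split; apply is_series_ext; intros n; [|symmetry]; apply E.
Qed.

(** Beyond the radius of convergence the terms do not even tend to 0. *)
Lemma CV_radius_gt (a : nat -> R) (rho x : R) :
  ex_pseries a rho -> Rabs x < Rabs rho -> Rbar_lt (Rabs x) (CV_radius a).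
Proof.
intros [l Hl] Hx.
destruct (Rbar_lt_dec (Rabs x) (CV_radius a)) as [H|H]; [exact H|exfalso].
apply Rbar_not_lt_le in H.
refine (CV_disk_outside a rho _ _).
- apply Rbar_le_lt_trans with (Rabs x); [exact H|exact Hx].
- apply ex_series_lim_0. exists l. now apply is_pseries_R_iff.
Qed.

Lemma CV_radius_gt_pos (a : nat -> R) (r x : R) :
  (forall h, 0 < h < r -> ex_pseries a h) -> Rabs x < r ->
  Rbar_lt (Rabs x) (CV_radius a).
Proof.
intros H Hx. pose proof (Rabs_pos x).
apply (CV_radius_gt a ((Rabs x + r) / 2)).
- apply H; lra.
- rewrite (Rabs_pos_eq ((Rabs x + r) / 2)); lra.
Qed.

(** A one-sided neighbourhood of 0 is enough, by continuity of the sum at 0.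
    One-sidedness matters: it is what allows continuing an identity past the
    boundary point of a half-line, and it lets the generating function of the
    Bernoulli numbers be used away from its removable singularity. *)
Lemma pseries_null_coef0 (a : nat -> R) (r : R) :
  0 < r -> (forall x, 0 < x < r -> is_pseries a x 0) -> a 0%nat = 0.
Proof.
intros Hr H.
assert (Hcv : Rbar_lt (Rabs 0) (CV_radius a)).
{ apply (CV_radius_gt_pos a r); [|rewrite Rabs_R0; lra].
  intros h Hh; exists 0; now apply H. }
apply PSeries_continuity in Hcv.
assert (Hl : is_lim_seq (fun n => PSeries a (r / (INR n + 2))) (PSeries a 0)).
{ apply is_lim_seq_continuous; [exact Hcv|].
  evar_last.
  - apply is_lim_seq_div with (l1 := r) (l2 := p_infty).
    + apply is_lim_seq_const.
    + eapply is_lim_seq_plus; [apply is_lim_seq_INR|apply is_lim_seq_const|].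
      reflexivity.
    + discriminate.
    + apply is_Rbar_div_p_infty.
  - reflexivity. }
rewrite PSeries_0 in Hl.
apply is_lim_seq_unique in Hl.
rewrite (Lim_seq_ext _ (fun _ => 0)), Lim_seq_const in Hl; [now injection Hl|].
intros k. apply is_pseries_unique, H. pose proof (pos_INR k).
split; [apply Rdiv_lt_0_compat; lra|].
apply Rmult_lt_reg_r with (INR k + 2); [lra|].
unfold Rdiv; rewrite Rmult_assoc, Rinv_l by lra. nra.
Qed.

Lemma pseries_null_coef (a : nat -> R) (r : R) :
  0 < r -> (forall x, 0 < x < r -> is_pseries a x 0) -> forall n, a n = 0.
Proof.
intros Hr H n; revert a H; induction n as [|n IH]; intros a H.
- now apply pseries_null_coef0 with r.
- apply (IH (PS_decr_1 a)). intros x Hx.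
  evar_last.
  + apply is_pseries_decr_1 with (y := / x); [|now apply H].
    unfold mult, one; simpl. apply Rinv_l; lra.
  + rewrite (pseries_null_coef0 a r Hr H).
    unfold scal, plus, opp; simpl; unfold mult; simpl; ring.
Qed.

Definition real_analytic_at (f : R -> R) (x0 : R) : Prop :=
  exists (a : nat -> R) (r : R), 0 < r /\
    forall h, Rabs h < r -> is_pseries a h (f (x0 + h)).

Lemma real_analytic_ext (f g : R -> R) (x0 : R) :
  (forall x, f x = g x) -> real_analytic_at f x0 -> real_analytic_at g x0.
Proof.
intros E [a [r [Hr Ha]]]. exists a, r; split; [exact Hr|].
intros h Hh. rewrite <- E. now apply Ha.
Qed.

Lemma real_analytic_plus (f g : R -> R) (x0 : R) :
  real_analytic_at f x0 -> real_analytic_at g x0 ->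
  real_analytic_at (fun x => f x + g x) x0.
Proof.
intros [a [r [Hr Ha]]] [b [s [Hs Hb]]].
exists (PS_plus a b), (Rmin r s); split; [now apply Rmin_pos|].
intros h Hh. pose proof (Rmin_l r s). pose proof (Rmin_r r s).
apply (is_pseries_plus a b h (f (x0 + h)) (g (x0 + h))); [apply Ha|apply Hb]; lra.
Qed.

Lemma real_analytic_mult (f g : R -> R) (x0 : R) :
  real_analytic_at f x0 -> real_analytic_at g x0 ->
  real_analytic_at (fun x => f x * g x) x0.
Proof.
intros [a [r [Hr Ha]]] [b [s [Hs Hb]]].
exists (PS_mult a b), (Rmin r s); split; [now apply Rmin_pos|].
intros h Hh. pose proof (Rmin_l r s). pose proof (Rmin_r r s).
apply (is_pseries_mult a b h (f (x0 + h)) (g (x0 + h))).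
- apply Ha; lra.
- apply Hb; lra.
- apply CV_radius_gt_pos with r; [|lra].
  intros k Hk. eexists; apply Ha. rewrite Rabs_pos_eq; lra.
- apply CV_radius_gt_pos with s; [|lra].
  intros k Hk. eexists; apply Hb. rewrite Rabs_pos_eq; lra.
Qed.

(** The factor [2^(1-s)], on a horizontal line, has real and imaginary parts of
    this form. *)
Lemma real_analytic_scal_exp (c k x0 : R) :
  real_analytic_at (fun x => c * exp (- x * k)) x0.
Proof.
exists (fun m => c * exp (- x0 * k) * ((- k) ^ m / INR (fact m))), 1; split; [lra|].
intros h _. apply is_pseries_R_iff.
pose proof (proj1 (is_pseries_R_iff _ _ _) (is_exp_Reals (- k * h))) as He.
apply (is_series_Rmult (c * exp (- x0 * k))) in He.
replace (c * exp (- (x0 + h) * k)) with (c * exp (- x0 * k) * exp (- k * h)).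
2: { rewrite Rmult_assoc, <- exp_plus. do 2 f_equal. ring. }
revert He. apply is_series_ext. intros m. eqR. rewrite Rpow_mult_distr.
unfold Rdiv; ring.
Qed.

Lemma real_analytic_derive (f : R -> R) (x0 r : R) (a : nat -> R) : 0 < r ->
  (forall h, Rabs h < r -> is_pseries a h (f (x0 + h))) ->
  is_derive f x0 (a 1%nat).
Proof.
intros Hr Ha.
assert (Hcv : Rbar_lt (Rabs (x0 - x0)) (CV_radius a)).
{ rewrite Rminus_diag. apply CV_radius_gt_pos with r; [|rewrite Rabs_R0; lra].
  intros h Hh; eexists; apply Ha; rewrite Rabs_pos_eq; lra. }
apply is_derive_ext_loc with (fun x => PSeries a (x - x0)).
- exists (mkposreal r Hr). intros x Hx.
  replace (f x) with (f (x0 + (x - x0))) by (f_equal; ring).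
  apply is_pseries_unique, Ha. exact Hx.
- evar_last.
  + apply (is_derive_comp (PSeries a) (fun x => x - x0)).
    * apply is_derive_PSeries. exact Hcv.
    * auto_derive; [trivial|reflexivity].
  + rewrite Rminus_diag, PSeries_0. unfold PS_derive, scal; simpl; unfold mult; simpl. ring.
Qed.

Lemma real_analytic_continuous (f : R -> R) (x0 : R) :
  real_analytic_at f x0 -> continuous f x0.
Proof.
intros [a [r [Hr Ha]]]. apply continuous_of_ex_derive.
eexists. exact (real_analytic_derive f x0 r a Hr Ha).
Qed.

(** Identity theorem on a half-line.  At the supremum of the points where [f] is
    nonzero the local power series vanishes on the right, so it has only null
    coefficients, and [f] vanishes to the left as well. *)
Lemma real_analytic_zero (f : R -> R) (c d : R) :
  (forall x, c < x -> real_analytic_at f x) ->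
  (forall x, d < x -> f x = 0) -> forall x, c < x -> f x = 0.
Proof.
intros Hf H0 x1 Hx1. destruct (Req_dec (f x1) 0) as [|Hn]; [assumption|exfalso].
destruct (completeness (fun t => c < t /\ f t <> 0)) as [T [Hub Hlub]].
- exists d. intros t [_ Ht]. destruct (Rle_or_lt t d) as [|Hd]; [assumption|].
  exfalso; apply Ht, H0, Hd.
- now exists x1.
- assert (HT : x1 <= T) by now apply Hub.
  assert (Hz : forall t, T < t -> f t = 0).
  { intros t Ht. destruct (Req_dec (f t) 0) as [|Hft]; [assumption|].
    assert (t <= T); [|lra]. apply Hub; split; [lra|assumption]. }
  destruct (Hf T ltac:(lra)) as [a [r [Hr Ha]]].
  assert (Ha0 : forall n, a n = 0).
  { apply pseries_null_coef with r; [exact Hr|]. intros x Hx.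
    rewrite <- (Hz (T + x)) by lra. apply Ha. rewrite Rabs_pos_eq; lra. }
  assert (HT' : T <= T - r); [|lra].
  apply Hlub. intros t [Hc Ht]. destruct (Rle_or_lt t (T - r)) as [|Hlt]; [assumption|].
  destruct Ht. destruct (Rlt_or_le T t) as [|HtT]; [now apply Hz|].
  assert (Hp : is_pseries a (t - T) (f t)).
  { replace (f t) with (f (T + (t - T))) by (f_equal; ring).
    apply Ha. rewrite Rabs_left1; lra. }
  apply is_pseries_unique in Hp. rewrite <- Hp, (PSeries_ext _ (fun _ => 0)) by exact Ha0.
  apply PSeries_const_0.
Qed.

(** The factors [cos(m PI/2)] run through 1, 0, -1, 0; with them the cosine has
    the shape of an exponential series with bounded signs, so that one lemma
    ([alt_sum_ptrig_pseries]) serves both. *)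
Lemma is_series_cos (z : R) :
  is_series (fun m => cos (INR m * (PI / 2)) * (z ^ m / INR (fact m))) (cos z).
Proof.
apply is_series_ext with (fun m => cos (INR m * (PI / 2)) / INR (fact m) * z ^ m).
{ intros m. eqR. unfold Rdiv; ring. }
apply is_pseries_R_iff.
assert (Hq : forall n, cos (INR (2 * n) * (PI / 2)) = (-1) ^ n /\
                       sin (INR (2 * n) * (PI / 2)) = 0).
{ intros n. replace (INR (2 * n) * (PI / 2)) with (INR n * PI)
    by (rewrite mult_INR; simpl; field).
  induction n as [|n [IHc IHs]].
  - simpl. rewrite Rmult_0_l, cos_0, sin_0. auto.
  - rewrite S_INR, Rmult_plus_distr_r, Rmult_1_l, cos_plus, sin_plus, IHc, IHs,
      cos_PI, sin_PI. simpl. split; ring. }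
replace (cos z) with (cos z + z * 0) by ring.
apply is_pseries_odd_even.
- apply is_pseries_R_iff.
  assert (Hc : is_series (fun n => cos_n n * Rsqr z ^ n) (cos z)).
  { apply is_series_Reals. unfold cos. destruct (exist_cos (Rsqr z)) as [l Hl]. exact Hl. }
  revert Hc. apply is_series_ext. intros n. eqR. rewrite (proj1 (Hq n)).
  unfold cos_n, Rsqr. simpl (z ^ 2). rewrite Rmult_1_r. reflexivity.
- apply is_pseries_R_iff. apply is_series_ext with (fun _ => 0).
  + intros n. eqR. rewrite plus_INR, Rmult_plus_distr_r. simpl (INR 1).
    rewrite Rmult_1_l, cos_plus, (proj2 (Hq n)), cos_PI2. unfold Rdiv; ring.
  + exact is_series_null.
Qed.

(** * Exchanging two summations *)

Lemma Series_sum_n (a : nat -> nat -> R) (M : nat) :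
  (forall m, ex_series (fun n => a n m)) ->
  is_series (fun n => sum_n (a n) M) (sum_n (fun m => Series (fun n => a n m)) M).
Proof.
intros H. induction M as [|M IH].
- rewrite sum_O. apply is_series_ext with (fun n => a n 0%nat).
  + intros n; now rewrite sum_O.
  + apply Series_correct, H.
- rewrite sum_n_succ.
  apply is_series_ext with (fun n => sum_n (a n) M + a n (S M)).
  + intros n; now rewrite sum_n_succ.
  + apply is_series_Rplus; [exact IH|apply Series_correct, H].
Qed.

Lemma is_series_geom_scal (c q : R) : 0 <= q < 1 ->
  is_series (fun m => c * q ^ m) (c / (1 - q)).
Proof.
intros Hq. apply is_series_Rmult.
apply is_series_geom. rewrite Rabs_pos_eq; lra.
Qed.

Lemma Series_tail_geom (b : nat -> R) (c q : R) (M : nat) : 0 <= q < 1 ->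
  (forall m, Rabs (b m) <= c * q ^ m) ->
  Rabs (Series b - sum_n b M) <= c / (1 - q) * q ^ S M.
Proof.
intros Hq Hb.
assert (Hex : ex_series b).
{ apply (ex_series_le (V := R_CompleteNormedModule)) with (fun m => c * q ^ m);
    [exact Hb|eexists; now apply is_series_geom_scal]. }
rewrite (Series_incr_n b (S M)) by (try lia; exact Hex).
simpl Nat.pred. rewrite <- sum_n_Reals.
replace (sum_n b M + Series (fun k => b (S M + k)%nat) - sum_n b M)
  with (Series (fun k => b (S M + k)%nat)) by ring.
assert (Hg := is_series_geom_scal (c * q ^ S M) q Hq).
assert (Hle : forall k, Rabs (b (S M + k)%nat) <= c * q ^ S M * q ^ k).
{ intros k. rewrite Rmult_assoc, <- pow_add. apply Hb. }
eapply Rle_trans; [apply Series_Rabs|].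
- apply (ex_series_le (V := R_CompleteNormedModule)) with (fun k => c * q ^ S M * q ^ k).
  + intros k. unfold norm; simpl; unfold abs; simpl. rewrite Rabs_Rabsolu. apply Hle.
  + eexists; exact Hg.
- eapply Rle_trans.
  + apply Series_le; [|eexists; exact Hg]. intros k. split; [apply Rabs_pos|apply Hle].
  + rewrite (is_series_unique _ _ Hg). right. unfold Rdiv; ring.
Qed.

(** A geometric bound in [m], uniform in [n] up to a summable factor, makes the
    tail in [m] of the whole double series tend to 0. *)
Lemma is_series_swap (a : nat -> nat -> R) (u : nat -> R) (q : R) :
  0 <= q < 1 -> ex_series u -> (forall n m, Rabs (a n m) <= u n * q ^ m) ->
  is_series (fun m => Series (fun n => a n m)) (Series (fun n => Series (a n))).
Proof.
intros Hq Hu Ha.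
assert (Hm : forall m, ex_series (fun n => a n m)).
{ intros m. apply (ex_series_le (V := R_CompleteNormedModule)) with (fun n => u n * q ^ m).
  - intros n; apply Ha.
  - now apply ex_series_scal_r. }
assert (Hd : forall M, ex_series (fun n => Series (a n) - sum_n (a n) M)).
{ intros M. apply (ex_series_le (V := R_CompleteNormedModule))
    with (fun n => u n * (/ (1 - q) * q ^ S M)).
  - intros n. unfold norm; simpl; unfold abs; simpl.
    rewrite <- Rmult_assoc. now apply Series_tail_geom.
  - now apply ex_series_scal_r. }
assert (Hs : ex_series (fun n => Series (a n))).
{ apply ex_series_ext with (fun n => (Series (a n) - sum_n (a n) 0) + sum_n (a n) 0).
  - intros n; eqR; ring.
  - apply (ex_series_plus (fun n => Series (a n) - sum_n (a n) 0)); [apply Hd|].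
    eexists; now apply Series_sum_n. }
change (is_lim_seq (sum_n (fun m => Series (fun n => a n m)))
  (Series (fun n => Series (a n)))).
set (S0 := Series (fun n => Series (a n))).
apply is_lim_seq_ext with (fun M => S0 - Series (fun n => Series (a n) - sum_n (a n) M)).
{ intros M. rewrite (Series_minus _ (fun n => sum_n (a n) M)).
  - rewrite (is_series_unique _ _ (Series_sum_n a M Hm)). unfold S0; ring.
  - exact Hs.
  - eexists; now apply Series_sum_n. }
evar_last.
- apply is_lim_seq_minus'; [apply is_lim_seq_const|].
  apply is_lim_seq_abs_0.
  apply is_lim_seq_le_le with (u := fun _ => 0)
    (w := fun M => Series u / (1 - q) * q * q ^ M).
  + intros M. split; [apply Rabs_pos|].
    assert (Hle : forall n, Rabs (Series (a n) - sum_n (a n) M)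
       <= u n * (/ (1 - q) * q ^ S M)).
    { intros n. rewrite <- Rmult_assoc. now apply Series_tail_geom. }
    assert (Hex : ex_series (fun n => u n * (/ (1 - q) * q ^ S M)))
      by now apply ex_series_scal_r.
    eapply Rle_trans; [apply Series_Rabs|].
    * apply (ex_series_le (V := R_CompleteNormedModule))
        with (fun n => u n * (/ (1 - q) * q ^ S M)); [|exact Hex].
      intros n. unfold norm; simpl; unfold abs; simpl. rewrite Rabs_Rabsolu. apply Hle.
    * eapply Rle_trans.
      { apply Series_le; [|exact Hex]. intros n; split; [apply Rabs_pos|apply Hle]. }
      rewrite Series_scal_r. right. simpl. unfold Rdiv; ring.
  + apply is_lim_seq_const.
  + evar_last.
    * apply is_lim_seq_mult'; [apply is_lim_seq_const|].
      apply is_lim_seq_geom. rewrite Rabs_pos_eq; lra.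
    * simpl; apply f_equal; ring.
- simpl; apply f_equal; ring.
Qed.

(** * Bernoulli numbers and polynomials *)

Section Bernoulli.
Variable B : nat -> R.
Hypothesis HB : is_bernoulli_numbers B.

Definition beta (j : nat) : R := B j / INR (fact j).

(** The coefficients of [exp z * (z / (exp z - 1)) = z / (exp z - 1) + z]. *)
Lemma beta_conv (n : nat) :
  PS_mult beta (fun j => / INR (fact j)) n
  = beta n + (if Nat.eq_dec n 1 then 1 else 0).
Proof.
destruct HB as [r [Hr H]].
set (d := fun n : nat => if Nat.eq_dec n 1 then 1 else 0).
set (e := fun j : nat => / INR (fact j)).
enough (E : PS_minus (PS_mult beta e) (PS_plus beta d) n = 0).
{ unfold PS_minus, PS_plus, PS_opp, plus, opp in E; simpl in E.
  unfold d in E; fold e. lra. }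
apply pseries_null_coef with r; [exact Hr|]. intros x Hx.
assert (Hcv : Rbar_lt (Rabs x) (CV_radius beta)).
{ apply CV_radius_gt_pos with r; [|rewrite Rabs_pos_eq; lra].
  intros h Hh. eexists. apply H; [|rewrite Rabs_pos_eq]; lra. }
assert (Hb : is_pseries beta x (x / (exp x - 1))).
{ apply H; [|rewrite Rabs_pos_eq]; lra. }
assert (He : exp x - 1 <> 0).
{ pose proof (exp_ineq1 x ltac:(lra)). lra. }
evar_last.
- apply is_pseries_minus.
  + apply is_pseries_mult; [exact Hb|apply is_exp_Reals|exact Hcv|].
    apply CV_radius_gt_pos with (Rabs x + 1); [|lra].
    intros h _; eexists; apply is_exp_Reals.
  + apply is_pseries_plus; [exact Hb|].
    apply is_pseries_R_iff.
    apply (is_series_decr_n _ 2 x); [lia|].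
    apply is_series_ext with (fun _ => 0).
    * intros k; unfold d; simpl. destruct k; simpl; ring.
    * evar_last; [apply filterlim_ext with (fun _ => 0)|].
      { intros k. rewrite sum_n_const. ring. }
      { apply filterlim_const. }
      unfold d, sum_n, sum_n_m, Iter.iter_nat, plus, opp, zero; simpl; ring.
- unfold plus, opp; simpl. field. exact He.
Qed.

Lemma beta_0 : beta 0 = 1.
Proof.
pose proof (beta_conv 1) as H. unfold PS_mult in H; simpl in H. lra.
Qed.

Lemma beta_1 : beta 1 = - / 2.
Proof.
pose proof (beta_conv 2) as H. unfold PS_mult in H; simpl in H.
rewrite beta_0 in H. lra.
Qed.

Lemma beta_2 : beta 2 = / 12.
Proof.
pose proof (beta_conv 3) as H. unfold PS_mult in H; simpl in H.
rewrite beta_0, beta_1 in H. lra.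
Qed.

(** The Bernoulli polynomial divided by the factorial of its degree, so that
    differentiation lowers the degree with no factor. *)
Definition bpoly (n : nat) (t : R) : R :=
  PS_mult beta (fun j => t ^ j / INR (fact j)) n.

Lemma bpoly_at_0 (n : nat) : bpoly n 0 = beta n.
Proof.
unfold bpoly, PS_mult. destruct n as [|n]; [simpl; field|].
rewrite tech5, Nat.sub_diag.
rewrite (sum_eq _ (fun _ => 0)).
- rewrite sum_cte. simpl; field.
- intros i Hi. replace (S n - i)%nat with (S (n - i)) by lia.
  simpl pow. unfold Rdiv; ring.
Qed.

Lemma bpoly_at_1 (n : nat) :
  bpoly n 1 = beta n + (if Nat.eq_dec n 1 then 1 else 0).
Proof.
rewrite <- beta_conv. apply sum_eq. intros i _. rewrite pow1. field.
apply INR_fact_neq_0.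
Qed.

Lemma is_derive_bpoly (n : nat) (t : R) :
  is_derive (bpoly (S n)) t (bpoly n t).
Proof.
unfold bpoly, PS_mult.
apply is_derive_ext with (fun u =>
  sum_f_R0 (fun k => beta k * (u ^ S (n - k) / INR (fact (S (n - k))))) n
  + beta (S n)).
{ intros u. rewrite tech5, Nat.sub_diag. simpl (u ^ 0). simpl (fact 0).
  rewrite (sum_eq _ (fun k => beta k * (u ^ (S n - k) / INR (fact (S n - k)))) n).
  - simpl; field.
  - intros i Hi. now replace (S n - i)%nat with (S (n - i)) by lia. }
evar_last.
- apply @is_derive_plus; [|apply @is_derive_const].
  apply (is_derive_sum_f_R0
    (fun k u => beta k * (u ^ S (n - k) / INR (fact (S (n - k)))))
    (fun k u => beta k * (u ^ (n - k) / INR (fact (n - k))))).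
  intros k _.
  pose proof (INR_fact_neq_0 (n - k)). pose proof (not_0_INR (S (n - k)) ltac:(lia)).
  rewrite fact_simpl, mult_INR.
  auto_derive; [trivial|].
  change (match (n - k)%nat with 0%nat => 1 | S _ => INR (n - k) + 1 end)
    with (INR (S (n - k))).
  field; auto.
- unfold plus, zero; simpl; ring.
Qed.

Lemma is_derive_bpoly_refl (n : nat) (t : R) :
  is_derive (fun u => bpoly (S n) (1 - u)) t (- bpoly n (1 - t)).
Proof.
evar_last.
- apply (is_derive_comp (bpoly (S n)) (fun u => 1 - u)).
  + apply is_derive_bpoly.
  + auto_derive; [trivial|reflexivity].
- unfold scal; simpl; unfold mult; simpl; ring.
Qed.

(** Reflection symmetry, by integrating twice.  The odd case could be off by a
    constant [c]; integrating it once more gives an affine defect of slope [-c]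
    that vanishes at both 0 and 1. *)
Lemma bpoly_sym_pair (m : nat) (t : R) :
  bpoly (2 * m + 1) (1 - t) = - bpoly (2 * m + 1) t /\
  bpoly (2 * m + 2) (1 - t) = bpoly (2 * m + 2) t.
Proof.
revert t; induction m as [|m IH]; intros t.
- assert (E1 : forall u, bpoly 1 u = u - / 2).
  { intros u. unfold bpoly, PS_mult; simpl. rewrite beta_0, beta_1. field. }
  split; simpl.
  + rewrite !E1; field.
  + assert (H := affine_of_const_derive
      (fun u => bpoly 2 (1 - u) - bpoly 2 u) 0).
    cbv beta in H. rewrite Rminus_0_r, bpoly_at_0, bpoly_at_1 in H.
    simpl in H. enough (bpoly 2 (1 - t) - bpoly 2 t = 0) by lra.
    rewrite H; [ring|]. intros u. evar_last.
    * apply @is_derive_minus; [apply is_derive_bpoly_refl|apply is_derive_bpoly].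
    * rewrite !E1. unfold minus, plus, opp; simpl. field.
- set (p := (2 * m + 2)%nat) in *.
  replace (2 * S m + 1)%nat with (S p) by (unfold p; lia).
  replace (2 * S m + 2)%nat with (S (S p)) by (unfold p; lia).
  (* the possible defect of antisymmetry, a constant by induction *)
  set (c := bpoly (S p) (1 - 0) + bpoly (S p) 0).
  assert (Ho : forall u, bpoly (S p) (1 - u) + bpoly (S p) u = c).
  { intros u. rewrite (affine_of_const_derive
      (fun v => bpoly (S p) (1 - v) + bpoly (S p) v) 0).
    - unfold c; ring.
    - intros v. evar_last.
      + apply @is_derive_plus; [apply is_derive_bpoly_refl|apply is_derive_bpoly].
      + rewrite (proj2 (IH v)). unfold plus; simpl; ring. }
  assert (He : forall u, bpoly (S (S p)) (1 - u) - bpoly (S (S p)) u = - c * u).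
  { intros u. rewrite (affine_of_const_derive
      (fun v => bpoly (S (S p)) (1 - v) - bpoly (S (S p)) v) (- c)).
    - rewrite Rminus_0_r, bpoly_at_0, bpoly_at_1.
      destruct (Nat.eq_dec (S (S p)) 1); [lia|]. ring.
    - intros v. evar_last.
      + apply @is_derive_minus; [apply is_derive_bpoly_refl|apply is_derive_bpoly].
      + rewrite <- (Ho v). unfold minus, plus, opp; simpl; ring. }
  assert (c = 0) as Hc.
  { pose proof (He 1) as H. rewrite Rminus_diag, bpoly_at_0, bpoly_at_1 in H.
    destruct (Nat.eq_dec (S (S p)) 1); [lia|]. lra. }
  specialize (Ho t). specialize (He t). rewrite Hc in Ho, He. lra.
Qed.

Lemma beta_odd (m : nat) : beta (2 * m + 3) = 0.
Proof.
pose proof (proj1 (bpoly_sym_pair (S m) 0)) as H.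
replace (2 * S m + 1)%nat with (2 * m + 3)%nat in H by lia.
rewrite Rminus_0_r, bpoly_at_0, bpoly_at_1 in H.
destruct (Nat.eq_dec (2 * m + 3) 1); [lia|]. lra.
Qed.

Lemma bpoly_odd_half (m : nat) : bpoly (2 * m + 1) (/ 2) = 0.
Proof.
pose proof (proj1 (bpoly_sym_pair m (/ 2))) as H.
replace (1 - / 2) with (/ 2) in H by field. lra.
Qed.

(** From degree 3 on, an odd polynomial vanishes at 0 and 1/2 and has the previous
    one as second derivative, so the sign alternates by convexity. *)
Lemma bpoly_odd_sign (m : nat) (t : R) :
  0 < t < / 2 -> 0 < (-1) ^ S m * bpoly (2 * m + 1) t.
Proof.
revert t; induction m as [|m IH]; intros t Ht.
- unfold bpoly, PS_mult; simpl. rewrite beta_0, beta_1. lra.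
- enough ((-1) ^ S m * bpoly (2 * S m + 1) t < 0) by
    (change ((-1) ^ S (S m)) with (-1 * (-1) ^ S m); lra).
  assert (D : forall n u,
    is_derive (fun v => (-1) ^ S m * bpoly (S n) v) u ((-1) ^ S m * bpoly n u)).
  { intros n u. apply is_derive_scal, is_derive_bpoly. }
  replace (2 * S m + 1)%nat with (S (S (2 * m + 1))) by lia.
  apply (convex_neg (fun u => (-1) ^ S m * bpoly (S (S (2 * m + 1))) u)
    (fun u => (-1) ^ S m * bpoly (S (2 * m + 1)) u)
    (fun u => (-1) ^ S m * bpoly (2 * m + 1) u) 0 (/ 2)); auto.
  + replace (S (S (2 * m + 1))) with (2 * m + 3)%nat by lia.
    rewrite bpoly_at_0, beta_odd; ring.
  + replace (S (S (2 * m + 1))) with (2 * S m + 1)%nat by lia.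
    rewrite bpoly_odd_half; ring.
Qed.

(** On (0,1/2) the odd polynomials give the monotonicity; the reflection
    symmetry covers the other half. *)
Lemma bpoly_even_sign (m : nat) (t : R) :
  0 < t < 1 -> 0 < (-1) ^ S m * (bpoly (2 * m + 2) t - beta (2 * m + 2)).
Proof.
assert (H : forall u, 0 < u <= / 2 ->
  0 < (-1) ^ S m * (bpoly (2 * m + 2) u - beta (2 * m + 2))).
{ intros u Hu.
  pose proof (increasing_of_derive (fun v => (-1) ^ S m * bpoly (2 * m + 2) v)
    (fun v => (-1) ^ S m * bpoly (2 * m + 1) v) 0 (/ 2)) as Hi.
  rewrite <- (bpoly_at_0 (2 * m + 2)).
  enough ((-1) ^ S m * bpoly (2 * m + 2) 0 < (-1) ^ S m * bpoly (2 * m + 2) u)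
    by lra.
  apply Hi; try lra.
  - intros v _. replace (2 * m + 2)%nat with (S (2 * m + 1)) by lia.
    apply is_derive_scal, is_derive_bpoly.
  - intros v Hv. now apply bpoly_odd_sign. }
intros Ht. destruct (Rle_dec t (/ 2)) as [Hl|Hl].
- apply H; lra.
- rewrite <- (proj2 (bpoly_sym_pair m t)). apply H; lra.
Qed.

(** * One step of the Euler-Maclaurin formula *)

Section EulerMaclaurin.
Variable g : nat -> R -> R.
Hypothesis Hg : forall i t, 0 < t -> is_derive (g i) t (g (S i) t).

(** The error of the trapezoidal rule for [g 1] on [x, x+1], after the first [p]
    Bernoulli corrections; [g] is a chain of successive derivatives starting with
    a primitive of [g 1]. *)
Definition em_step (p : nat) (x : R) : R :=
  g 0%nat (x + 1) - g 0%nat x - (g 1%nat (x + 1) + g 1%nat x) / 2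
  + sum_n_m (fun j => beta (2 * j) * (g (2 * j)%nat (x + 1) - g (2 * j)%nat x)) 1 p.

(** Repeated integration by parts against the Bernoulli polynomials, written as a
    primitive: the derivative of this sum telescopes. *)
Definition em_primitive (M : nat) (x t : R) : R :=
  sum_f_R0 (fun i => (-1) ^ i * (bpoly i t * g i (x + t))) M.

Lemma is_derive_shift (i : nat) (x t : R) : 0 < x -> 0 <= t ->
  is_derive (fun u => g i (x + u)) t (g (S i) (x + t)).
Proof.
intros Hx Ht. evar_last.
- apply (is_derive_comp (g i) (fun u => x + u)).
  + apply Hg; lra.
  + auto_derive; [trivial|reflexivity].
- unfold scal; simpl; unfold mult; simpl; ring.
Qed.

Lemma is_derive_em_primitive (M : nat) (x t : R) : 0 < x -> 0 <= t ->
  is_derive (em_primitive M x) t ((-1) ^ M * (bpoly M t * g (S M) (x + t))).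
Proof.
intros Hx Ht. unfold em_primitive; induction M as [|M IH]; simpl sum_f_R0.
- apply is_derive_ext with (fun u => g 0%nat (x + u)).
  { intros u. unfold bpoly, PS_mult; simpl. rewrite beta_0. field. }
  evar_last; [now apply is_derive_shift|].
  unfold bpoly, PS_mult; simpl. rewrite beta_0. field.
- evar_last.
  + apply @is_derive_plus; [exact IH|].
    apply is_derive_scal, @is_derive_mult.
    * apply is_derive_bpoly.
    * now apply is_derive_shift.
    * intros; apply Rmult_comm.
  + unfold plus, mult; simpl; ring.
Qed.

Lemma em_primitive_boundary (p : nat) (x : R) :
  em_primitive (2 * p + 2) x 1 - em_primitive (2 * p + 2) x 0
  = em_step p x
    + beta (2 * p + 2) * (g (2 * p + 2)%nat (x + 1) - g (2 * p + 2)%nat x).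
Proof.
unfold em_primitive, em_step. induction p as [|p IH].
- simpl sum_f_R0. rewrite sum_n_m_zero by lia.
  rewrite !bpoly_at_0, !bpoly_at_1. simpl.
  rewrite (Rplus_0_r x), beta_0, beta_1. unfold zero; simpl. field.
- replace (2 * S p + 2)%nat with (S (S (2 * p + 2))) by lia.
  rewrite !tech5. rewrite !bpoly_at_0, !bpoly_at_1.
  rewrite (Rplus_0_r x) in IH |- *.
  rewrite sum_n_Sm by lia.
  replace (2 * S p)%nat with (2 * p + 2)%nat by lia.
  replace (S (2 * p + 2)) with (2 * p + 3)%nat by lia.
  rewrite beta_odd.
  assert (E : (-1) ^ S (2 * p + 3) = 1).
  { replace (S (2 * p + 3)) with (2 * (p + 2))%nat by lia. apply pow_1_even. }
  rewrite E.
  destruct (Nat.eq_dec (2 * p + 3) 1); [lia|].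
  destruct (Nat.eq_dec (S (2 * p + 3)) 1); [lia|].
  change plus with Rplus. lra.
Qed.

(** The corrected trapezoidal error is the integral over (0,1) of
    [(bpoly (2p+2) t - beta (2p+2)) * g (2p+3) (x+t)], an integrand of constant
    sign; the argument is run on a primitive of it. *)
Lemma em_step_sign (p : nat) (x : R) : 0 < x ->
  (forall t, x < t < x + 1 -> 0 < g (2 * p + 3)%nat t) ->
  0 < (-1) ^ S p * em_step p x.
Proof.
intros Hx Hs.
pose proof (increasing_of_derive
  (fun t => (-1) ^ S p * (em_primitive (2 * p + 2) x t
     - beta (2 * p + 2) * g (2 * p + 2)%nat (x + t)))
  (fun t => (-1) ^ S p * ((bpoly (2 * p + 2) t - beta (2 * p + 2))
     * g (2 * p + 3)%nat (x + t))) 0 1) as H.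
cbv beta in H.
enough (E : (-1) ^ S p * (em_primitive (2 * p + 2) x 0
     - beta (2 * p + 2) * g (2 * p + 2)%nat (x + 0))
   < (-1) ^ S p * (em_primitive (2 * p + 2) x 1
     - beta (2 * p + 2) * g (2 * p + 2)%nat (x + 1))).
{ pose proof (em_primitive_boundary p x) as Hb. rewrite Rplus_0_r in E.
  replace (em_step p x) with
    (em_primitive (2 * p + 2) x 1 - beta (2 * p + 2) * g (2 * p + 2)%nat (x + 1)
     - (em_primitive (2 * p + 2) x 0 - beta (2 * p + 2) * g (2 * p + 2)%nat x)) by lra.
  lra. }
apply H; try lra.
- intros t Ht. apply is_derive_scal. evar_last.
  + apply @is_derive_minus; [apply is_derive_em_primitive; lra|].
    apply is_derive_scal, is_derive_shift; lra.
  + replace (2 * p + 2)%nat with (2 * (p + 1))%nat at 1 by lia.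
    rewrite pow_1_even. replace (S (2 * p + 2)) with (2 * p + 3)%nat by lia.
    unfold minus, plus, opp; simpl; ring.
- intros t Ht. rewrite <- Rmult_assoc. apply Rmult_lt_0_compat.
  + now apply bpoly_even_sign.
  + apply Hs; lra.
Qed.

End EulerMaclaurin.
End Bernoulli.

(** * Wallis's integrals *)

Definition wallis (n : nat) : R := RInt (fun t => sin t ^ n) 0 (PI / 2).

Lemma ex_RInt_sin_pow (n : nat) (a b : R) : ex_RInt (fun t => sin t ^ n) a b.
Proof.
apply (ex_RInt_continuous (V := R_CompleteNormedModule)). intros t _.
apply continuous_of_ex_derive. auto_derive; trivial.
Qed.

Lemma wallis_rec (n : nat) :
  (INR n + 2) * wallis (n + 2) = (INR n + 1) * wallis n.
Proof.
(* a primitive is [- cos t * sin t ^ (n + 1)], which vanishes at both ends *)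
assert (H : is_RInt (fun t => (INR n + 2) * sin t ^ (n + 2)
                              - (INR n + 1) * sin t ^ n) 0 (PI / 2) 0).
{ evar_last.
  - apply (is_RInt_derive (fun t => - cos t * sin t ^ (n + 1))).
    + intros t _. auto_derive; [trivial|].
      replace (Nat.pred (n + 1)) with n by lia.
      rewrite plus_INR. simpl (INR 1).
      replace (n + 1)%nat with (S n) by lia. replace (n + 2)%nat with (S (S n)) by lia.
      pose proof (sin2_cos2 t) as E. unfold Rsqr in E. simpl.
      transitivity (sin t ^ n * (sin t * sin t) - (INR n + 1) * sin t ^ n * (cos t * cos t));
        [ring|].
      replace (cos t * cos t) with (1 - sin t * sin t) by lra. ring.
    + intros t _. apply continuous_of_ex_derive. auto_derive; trivial.
  - rewrite cos_PI2, sin_0. unfold minus, plus, opp; simpl.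
    rewrite pow_i by lia. ring. }
apply (is_RInt_unique (V := R_CompleteNormedModule)) in H.
rewrite (RInt_minus (V := R_CompleteNormedModule)
  (fun t => (INR n + 2) * sin t ^ (n + 2)) (fun t => (INR n + 1) * sin t ^ n)) in H.
- rewrite !(RInt_scal (V := R_CompleteNormedModule)) in H
    by apply ex_RInt_sin_pow.
  unfold minus, plus, opp, scal in H; simpl in H; unfold mult in H; simpl in H.
  unfold wallis. lra.
- apply (ex_RInt_scal (V := R_CompleteNormedModule)), ex_RInt_sin_pow.
- apply (ex_RInt_scal (V := R_CompleteNormedModule)), ex_RInt_sin_pow.
Qed.

Lemma wallis_0 : wallis 0 = PI / 2.
Proof.
unfold wallis; simpl. rewrite (RInt_const (V := R_CompleteNormedModule)).
unfold scal; simpl; unfold mult; simpl; ring.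
Qed.

Lemma wallis_1 : wallis 1 = 1.
Proof.
apply (is_RInt_unique (V := R_CompleteNormedModule)). evar_last.
- apply (is_RInt_derive (fun t => - cos t)).
  + intros t _. auto_derive; [trivial|ring].
  + intros t _. apply continuous_of_ex_derive. auto_derive; trivial.
- rewrite cos_PI2, cos_0. unfold minus, plus, opp; simpl; ring.
Qed.

(** The two-step recurrence says that this quantity does not depend on [n]. *)
Lemma wallis_prod (n : nat) : (INR n + 1) * (wallis n * wallis (S n)) = PI / 2.
Proof.
induction n as [|n IH].
- rewrite wallis_0, wallis_1. simpl; ring.
- rewrite <- IH. pose proof (wallis_rec n) as E.
  replace (n + 2)%nat with (S (S n)) in E by lia. rewrite S_INR.
  transitivity (wallis (S n) * ((INR n + 2) * wallis (S (S n)))); [ring|].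
  rewrite E; ring.
Qed.

Lemma wallis_ge0 (n : nat) : 0 <= wallis n.
Proof.
pose proof PI_RGT_0.
apply RInt_ge_0; [lra|apply ex_RInt_sin_pow|].
intros t Ht. apply pow_le, sin_ge_0; lra.
Qed.

Lemma wallis_decr (n : nat) : wallis (S n) <= wallis n.
Proof.
pose proof PI_RGT_0.
apply RInt_le; [lra|apply ex_RInt_sin_pow..|].
intros t Ht. simpl. pose proof (SIN_bound t).
assert (0 <= sin t ^ n) by (apply pow_le, sin_ge_0; lra). nra.
Qed.

Lemma wallis_even (n : nat) :
  wallis (2 * n) = PI / 2 * (INR (fact (2 * n)) / (4 ^ n * INR (fact n) ^ 2)).
Proof.
induction n as [|n IH].
- simpl. rewrite wallis_0. field.
- pose proof (wallis_rec (2 * n)) as E.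
  replace (2 * n + 2)%nat with (2 * S n)%nat in E by lia.
  rewrite IH in E. rewrite mult_INR in E. simpl (INR 2) in E.
  replace (fact (2 * S n)) with ((2 * n + 2) * ((2 * n + 1) * fact (2 * n)))%nat.
  2: { replace (2 * S n)%nat with (S (S (2 * n))) by lia. rewrite !fact_simpl. lia. }
  rewrite fact_simpl, !mult_INR, !plus_INR, mult_INR, S_INR. simpl (INR 2); simpl (INR 1).
  pose proof (pos_INR n). pose proof (INR_fact_neq_0 n).
  assert (4 ^ n <> 0) by (apply pow_nonzero; lra).
  apply Rmult_eq_reg_l with (2 * INR n + 2); [|lra].
  replace (1 + 1) with 2 in * by ring. rewrite E. simpl (4 ^ S n).
  rewrite (S_INR n). field. repeat split; auto; lra.
Qed.

(** The product of two neighbours is known exactly and the integrals decrease, so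
    the square of one of them is squeezed. *)
Lemma wallis_lim : is_lim_seq (fun n => INR n * wallis (2 * n) ^ 2) (PI / 4).
Proof.
assert (HP := PI_RGT_0).
apply (is_lim_seq_incr_1 (fun n => INR n * wallis (2 * n) ^ 2)).
apply is_lim_seq_le_le with
  (u := fun n => PI / 4 - PI / 4 * / (2 * (INR n + 1) + 1)) (w := fun _ => PI / 4).
- intros n. rewrite S_INR. pose proof (pos_INR n).
  set (k := (2 * S n)%nat). set (I := wallis k).
  assert (HI : 0 <= I) by apply wallis_ge0.
  assert (Hk : INR k = 2 * (INR n + 1)).
  { unfold k; rewrite mult_INR, (S_INR n); simpl; ring. }
  pose proof (wallis_prod k) as E1. fold I in E1. rewrite Hk in E1.
  pose proof (wallis_prod (2 * n + 1)) as E2.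
  replace (S (2 * n + 1)) with k in E2 by (unfold k; lia). fold I in E2.
  replace (INR (2 * n + 1) + 1) with (2 * (INR n + 1)) in E2
    by (rewrite plus_INR, mult_INR; simpl; ring).
  pose proof (wallis_decr k) as D1. fold I in D1.
  pose proof (wallis_decr (2 * n + 1)) as D2.
  replace (S (2 * n + 1)) with k in D2 by (unfold k; lia). fold I in D2.
  split.
  + assert (PI / 2 <= (2 * (INR n + 1) + 1) * I ^ 2).
    { rewrite <- E1. apply Rmult_le_compat_l; nra. }
    replace (PI / 4 - PI / 4 * / (2 * (INR n + 1) + 1))
      with ((INR n + 1) * (PI / 2 * / (2 * (INR n + 1) + 1))) by (field; lra).
    apply Rmult_le_compat_l; [lra|].
    apply Rmult_le_reg_r with (2 * (INR n + 1) + 1); [lra|].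
    rewrite Rmult_assoc, Rinv_l by lra. lra.
  + assert (2 * (INR n + 1) * I ^ 2 <= PI / 2).
    { rewrite <- E2. apply Rmult_le_compat_l; nra. }
    lra.
- evar_last.
  + apply is_lim_seq_minus'; [apply is_lim_seq_const|].
    apply is_lim_seq_mult'; [apply is_lim_seq_const|].
    apply is_lim_seq_inv_infty.
    apply is_lim_seq_plus with p_infty 1; [|apply is_lim_seq_const|reflexivity].
    apply is_lim_seq_ext with (fun n => INR (2 * (n + 1))).
    { intros n; rewrite mult_INR, plus_INR; simpl; ring. }
    apply (is_lim_seq_subseq INR p_infty (fun n => (2 * (n + 1))%nat)); [|apply is_lim_seq_INR].
    apply eventually_subseq; intros; lia.
  + simpl; apply f_equal; ring.
- apply is_lim_seq_const.
Qed.

(** * Stirling's formula with an enveloping series *)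

(** The [k]-th derivative of the inverse. *)
Definition inv_derivative (k : nat) (t : R) : R := (-1) ^ k * INR (fact k) / t ^ S k.

Lemma is_derive_inv_derivative (k : nat) (t : R) : 0 < t ->
  is_derive (inv_derivative k) t (inv_derivative (S k) t).
Proof.
intros Ht. unfold inv_derivative.
assert (Hp : forall j, t ^ j <> 0) by (intros; apply pow_nonzero; lra).
evar_last.
- apply (is_derive_scal (fun u => / u ^ S k) t ((-1) ^ k * INR (fact k))).
  apply (is_derive_inv (fun u => u ^ S k)); [|apply Hp].
  apply is_derive_pow. apply @is_derive_id.
- unfold one; simpl Nat.pred. rewrite fact_simpl, mult_INR.
  simpl ((-1) ^ S k). specialize (Hp k). simpl. field. split; [exact Hp|lra].
Qed.

Lemma inv_derivative_even_pos (p : nat) (t : R) : 0 < t -> 0 < inv_derivative (2 * p) t.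
Proof.
intros Ht. unfold inv_derivative. rewrite pow_1_even, Rmult_1_l.
apply Rdiv_lt_0_compat; [apply INR_fact_lt_0|now apply pow_lt].
Qed.

Lemma inv_derivative_odd_neg (p : nat) (t : R) : 0 < t -> inv_derivative (2 * p + 1) t < 0.
Proof.
intros Ht. unfold inv_derivative.
assert (0 < INR (fact (2 * p + 1)) / t ^ S (2 * p + 1)).
{ apply Rdiv_lt_0_compat; [apply INR_fact_lt_0|now apply pow_lt]. }
replace (2 * p + 1)%nat with (S (2 * p)) in * by lia. rewrite pow_1_odd.
unfold Rdiv in *. lra.
Qed.

(** The logarithm is taken with a minus sign to make the functions of odd index
    from the third on positive, as [em_step_sign] requires. *)
Definition neg_ln_chain (i : nat) (t : R) : R :=
  match i with
  | 0%nat => t - t * ln t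
  | 1%nat => - ln t
  | S (S k) => - inv_derivative k t
  end.

Lemma neg_ln_chain_derive (i : nat) (t : R) : 0 < t ->
  is_derive (neg_ln_chain i) t (neg_ln_chain (S i) t).
Proof.
intros Ht. destruct i as [|[|k]]; unfold neg_ln_chain.
- auto_derive; [exact Ht|]. field; lra.
- unfold inv_derivative; simpl. auto_derive; [exact Ht|]. field; lra.
- apply @is_derive_opp. now apply is_derive_inv_derivative.
Qed.

(** Stirling's formula up to its constant. *)
Definition stirling_log (n : nat) : R :=
  ln (INR (fact n)) - (INR n + / 2) * ln (INR n) + INR n.

(** The error of Stirling's formula, that is, Binet's function at the integers. *)
Definition binet (n : nat) : R := stirling_log n - ln (2 * PI) / 2.

Section Stirling.
Variable B : nat -> R.
Hypothesis HB : is_bernoulli_numbers B.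

Definition stirling_coef (j : nat) : R :=
  B (2 * j)%nat / (2 * INR j * (2 * INR j - 1)).

Lemma stirling_coef_eq (j : nat) : (1 <= j)%nat ->
  stirling_coef j = beta B (2 * j) * INR (fact (2 * j - 2)).
Proof.
intros Hj. unfold stirling_coef, beta.
replace (fact (2 * j)) with (2 * j * ((2 * j - 1) * fact (2 * j - 2)))%nat.
- rewrite !mult_INR, minus_INR, mult_INR by lia. simpl (INR 2); simpl (INR 1).
  pose proof (INR_fact_neq_0 (2 * j - 2)). apply le_INR in Hj. simpl in Hj.
  field. repeat split; try lra; auto.
- destruct j as [|j]; [lia|].
  replace (2 * S j)%nat with (S (S (2 * j))) by lia.
  rewrite !fact_simpl. replace (S (S (2 * j)) - 2)%nat with (2 * j)%nat by lia.
  replace (S (S (2 * j)) - 1)%nat with (S (2 * j)) by lia. reflexivity.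
Qed.

Definition stirling_sum (p : nat) (x : R) : R :=
  sum_n_m (fun j => stirling_coef j / x ^ (2 * j - 1)) 1 p.

Lemma neg_ln_chain_even (j : nat) (t : R) : (1 <= j)%nat ->
  beta B (2 * j) * neg_ln_chain (2 * j) t = - (stirling_coef j / t ^ (2 * j - 1)).
Proof.
intros Hj. rewrite stirling_coef_eq by exact Hj.
destruct j as [|j]; [lia|].
replace (2 * S j)%nat with (S (S (2 * j))) at 2 by lia.
unfold neg_ln_chain, inv_derivative. rewrite pow_1_even.
replace (2 * S j - 1)%nat with (S (2 * j)) by lia.
replace (2 * S j - 2)%nat with (2 * j)%nat by lia.
unfold Rdiv; ring.
Qed.

Lemma em_step_neg_ln (p n : nat) : (1 <= n)%nat ->
  em_step B neg_ln_chain p (INR n)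
  = (stirling_log (S n) - stirling_sum p (INR (S n)))
    - (stirling_log n - stirling_sum p (INR n)).
Proof.
intros Hn. unfold em_step, stirling_sum.
rewrite (sum_n_m_ext_loc _ (fun j => stirling_coef j / INR n ^ (2 * j - 1)
    - stirling_coef j / INR (S n) ^ (2 * j - 1))).
- rewrite sum_n_m_Rminus. unfold stirling_log.
  rewrite fact_simpl, mult_INR, ln_mult.
  + rewrite S_INR. unfold neg_ln_chain, minus, plus, opp; simpl. field.
  + apply lt_0_INR; lia.
  + apply INR_fact_lt_0.
- intros j Hj. rewrite <- S_INR.
  pose proof (neg_ln_chain_even j (INR n) ltac:(lia)).
  pose proof (neg_ln_chain_even j (INR (S n)) ltac:(lia)).
lra.
Qed.

(** The Euler-Maclaurin steps of the logarithm are exactly the increments of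
    Stirling's approximation minus a partial sum of its series. *)
Lemma stirling_increment_sign (p n : nat) : (1 <= n)%nat ->
  (-1) ^ p * (stirling_log (S n) - stirling_sum p (INR (S n)))
  < (-1) ^ p * (stirling_log n - stirling_sum p (INR n)).
Proof.
intros Hn. pose proof (lt_0_INR n ltac:(lia)) as Hn0.
pose proof (em_step_sign B HB neg_ln_chain neg_ln_chain_derive p (INR n) Hn0) as H.
rewrite em_step_neg_ln in H by exact Hn.
change ((-1) ^ S p) with (-1 * (-1) ^ p) in H.
enough (0 < -1 * (-1) ^ p *
     (stirling_log (S n) - stirling_sum p (INR (S n)) -
      (stirling_log n - stirling_sum p (INR n)))) by lra.
apply H. intros t Ht.
replace (2 * p + 3)%nat with (S (S (2 * p + 1))) by lia.
unfold neg_ln_chain. pose proof (inv_derivative_odd_neg p t ltac:(lra)). lra.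
Qed.

Lemma stirling_sum_lim (p : nat) :
  is_lim_seq (fun n => stirling_sum p (INR (S n))) 0.
Proof.
unfold stirling_sum. induction p as [|p IH].
- apply is_lim_seq_ext with (fun _ => 0); [|apply is_lim_seq_const].
  intros n. rewrite sum_n_m_zero by lia. reflexivity.
- apply is_lim_seq_ext with (fun n =>
    sum_n_m (fun j => stirling_coef j / INR (S n) ^ (2 * j - 1)) 1 p
    + stirling_coef (S p) * / INR (S n) ^ (2 * S p - 1)).
  { intros n. rewrite sum_n_Sm by lia. reflexivity. }
  evar_last.
  + apply is_lim_seq_plus'; [exact IH|].
    apply is_lim_seq_mult'; [apply is_lim_seq_const|].
    apply is_lim_seq_inv_infty.
    apply (is_lim_seq_le_p_loc (fun n => INR (S n))).
    * exists 0%nat. intros n _. replace (2 * S p - 1)%nat with (S (2 * p)) by lia.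
      rewrite <- tech_pow_Rmult. rewrite <- (Rmult_1_r (INR (S n))) at 1.
      apply Rmult_le_compat_l; [apply pos_INR|].
      apply pow_R1_Rle. rewrite S_INR. pose proof (pos_INR n); lra.
    * apply (is_lim_seq_incr_1 INR), is_lim_seq_INR.
  + simpl; apply f_equal; ring.
Qed.

Lemma stirling_sum_1 (x : R) : stirling_sum 1 x = / (12 * x).
Proof.
unfold stirling_sum. rewrite sum_n_n, stirling_coef_eq by lia.
replace (2 * 1)%nat with 2%nat by lia. rewrite beta_2 by exact HB.
simpl. rewrite Rinv_mult. unfold Rdiv. rewrite !Rmult_1_r. reflexivity.
Qed.

(** With no correction term the sequence decreases, and with one correction term
    it increases. *)
Lemma stirling_log_cv : ex_finite_lim_seq (fun n => stirling_log (S n)).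
Proof.
apply ex_finite_lim_seq_decr with (stirling_log 1 - / 12).
- intros n. pose proof (stirling_increment_sign 0 (S n) ltac:(lia)) as H.
  unfold stirling_sum in H. rewrite !sum_n_m_zero in H by lia.
  unfold zero in H; simpl pow in H; simpl in H. lra.
- intros n.
  assert (H : stirling_log 1 - stirling_sum 1 (INR 1)
     <= stirling_log (S n) - stirling_sum 1 (INR (S n))).
  { induction n as [|n IH]; [lra|]. eapply Rle_trans; [exact IH|].
    pose proof (stirling_increment_sign 1 (S n) ltac:(lia)). lra. }
  rewrite !stirling_sum_1 in H. simpl (INR 1) in H.
  assert (0 < / (12 * INR (S n))).
  { apply Rinv_0_lt_compat. pose proof (lt_0_INR (S n) ltac:(lia)). lra. }
  lra.
Qed.

(** The central binomial coefficient, whose size Wallis's integrals give exactly,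
    pins down the constant in Stirling's formula. *)
Lemma wallis_stirling (n : nat) : (1 <= n)%nat ->
  ln (INR n * wallis (2 * n) ^ 2)
  = 2 * ln (PI / 2) + 2 * (stirling_log (2 * n) - 2 * stirling_log n) + ln 2.
Proof.
intros Hn. pose proof (lt_0_INR n ltac:(lia)) as Hn0. pose proof PI_RGT_0.
pose proof (INR_fact_lt_0 n). pose proof (INR_fact_lt_0 (2 * n)).
assert (0 < 4 ^ n) by (apply pow_lt; lra).
assert (0 < INR (fact n) ^ 2) by (apply pow_lt; assumption).
assert (Hd : 0 < 4 ^ n * INR (fact n) ^ 2) by (apply Rmult_lt_0_compat; assumption).
assert (Hq : 0 < INR (fact (2 * n)) / (4 ^ n * INR (fact n) ^ 2))
  by (apply Rdiv_lt_0_compat; assumption).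
assert (Hw : 0 < wallis (2 * n)).
{ rewrite wallis_even. apply Rmult_lt_0_compat; lra. }
rewrite ln_mult, ln_pow by (try assumption; apply pow_lt; assumption).
rewrite wallis_even, ln_mult, (ln_div (INR _)), (ln_mult (4 ^ n)), !ln_pow by lra.
replace 4 with (2 * 2) by ring. rewrite ln_mult by lra.
unfold stirling_log. rewrite mult_INR. simpl (INR 2).
replace (1 + 1) with 2 by ring. rewrite (ln_mult 2 (INR n)) by lra. field.
Qed.

Lemma stirling_log_lim : is_lim_seq (fun n => stirling_log (S n)) (ln (2 * PI) / 2).
Proof.
destruct stirling_log_cv as [l Hl].
replace (ln (2 * PI) / 2) with l; [exact Hl|].
pose proof PI_RGT_0.
assert (H1 : is_lim_seq (fun n => ln (INR (S n) * wallis (2 * S n) ^ 2)) (ln (PI / 4))).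
{ apply is_lim_seq_continuous with (f := ln).
  - apply continuity_pt_filterlim, continuous_of_ex_derive. auto_derive. lra.
  - apply (is_lim_seq_incr_1 (fun n => INR n * wallis (2 * n) ^ 2)), wallis_lim. }
assert (H2 : is_lim_seq (fun n => ln (INR (S n) * wallis (2 * S n) ^ 2))
  (2 * ln (PI / 2) + 2 * (l - 2 * l) + ln 2)).
{ apply is_lim_seq_ext with (fun n =>
    2 * ln (PI / 2) + 2 * (stirling_log (2 * S n) - 2 * stirling_log (S n)) + ln 2).
  { intros n; symmetry; apply wallis_stirling; lia. }
  apply is_lim_seq_plus'; [apply is_lim_seq_plus'|]; try apply is_lim_seq_const.
  apply is_lim_seq_mult'; [apply is_lim_seq_const|].
  apply is_lim_seq_minus'.
  - apply is_lim_seq_ext with (fun n => stirling_log (S (2 * n + 1))).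
    { intros n; f_equal; lia. }
    apply (is_lim_seq_subseq (fun n => stirling_log (S n)) l (fun n => (2 * n + 1)%nat));
      [|exact Hl].
    apply eventually_subseq; intros; lia.
  - apply is_lim_seq_mult'; [apply is_lim_seq_const|exact Hl]. }
apply is_lim_seq_unique in H1. apply is_lim_seq_unique in H2. rewrite H1 in H2.
injection H2 as E.
rewrite !ln_div in E by lra. replace 4 with (2 * 2) in E by ring.
rewrite ln_mult in E by lra. rewrite ln_mult by lra. lra.
Qed.

(** Consecutive partial sums of Stirling's series lie on opposite sides: a
    strictly decreasing sequence stays above its limit, here 0. *)
Lemma binet_envelope (p n : nat) : (1 <= n)%nat ->
  0 < (-1) ^ p * (binet n - stirling_sum p (INR n)).
Proof.
intros Hn. destruct n as [|n]; [lia|].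
set (w := fun k => (-1) ^ p * (stirling_log (S k) - stirling_sum p (INR (S k)))).
assert (Hd : forall k, w (S k) < w k).
{ intros k; apply stirling_increment_sign; lia. }
assert (Hl : is_lim_seq w ((-1) ^ p * (ln (2 * PI) / 2 - 0))).
{ apply is_lim_seq_mult'; [apply is_lim_seq_const|].
  apply is_lim_seq_minus'; [apply stirling_log_lim|apply stirling_sum_lim]. }
pose proof (is_lim_seq_decr_compare w _ Hl (fun k => Rlt_le _ _ (Hd k)) (S n)) as H.
specialize (Hd n). unfold binet. unfold w in *. lra.
Qed.

End Stirling.

(** * Existence of Glaisher's and Euler's limits *)

Definition t_ln_chain (i : nat) (t : R) : R :=
  match i with
  | 0%nat => t ^ 2 / 2 * ln t - t ^ 2 / 4
  | 1%nat => t * ln t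
  | 2%nat => ln t + 1
  | S (S (S k)) => inv_derivative k t
  end.

Lemma t_ln_chain_derive (i : nat) (t : R) : 0 < t ->
  is_derive (t_ln_chain i) t (t_ln_chain (S i) t).
Proof.
intros Ht. destruct i as [|[|[|k]]]; unfold t_ln_chain.
- auto_derive; [exact Ht|]. field; lra.
- auto_derive; [exact Ht|]. field; lra.
- unfold inv_derivative; simpl. auto_derive; [exact Ht|]. field; lra.
- now apply is_derive_inv_derivative.
Qed.

(** Its limit is [-zeta'(-1)]: the terms subtracted are the Euler-Maclaurin
    approximation of the sum, including the constant [1/12] that separates
    [-zeta'(-1)] from the logarithm of the Glaisher-Kinkelin constant. *)
Definition glaisher_seq (n : nat) : R :=
  sum_n_m (fun v => INR v * ln (INR v)) 1 n - INR n * ln (INR n) / 2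
  - (INR n ^ 2 / 2 * ln (INR n) - INR n ^ 2 / 4) - (ln (INR n) + 1) / 12.

Lemma glaisher_seq_step (B : nat -> R) (HB : is_bernoulli_numbers B) (n : nat) :
  em_step B t_ln_chain 1 (INR n) = glaisher_seq n - glaisher_seq (S n).
Proof.
unfold em_step, glaisher_seq. rewrite sum_n_n, sum_n_Sm by lia.
change (@plus _) with Rplus.
replace (2 * 1)%nat with 2%nat by lia. rewrite beta_2, <- S_INR by exact HB.
unfold t_ln_chain, plus; simpl; field.
Qed.

(** The step with one Bernoulli term is positive, so the sequence decreases; the
    step with two terms is negative, and the additional term telescopes to a
    bounded quantity, so the sequence is bounded below. *)
Lemma glaisher_seq_cv (B : nat -> R) (HB : is_bernoulli_numbers B) :
  ex_finite_lim_seq (fun n => glaisher_seq (S n)).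
Proof.
pose proof (em_step_sign B HB t_ln_chain t_ln_chain_derive) as Hs.
set (b := beta B 4).
apply ex_finite_lim_seq_decr with (glaisher_seq 1 + b - Rabs b).
- intros n. specialize (Hs 1%nat (INR (S n)) (lt_0_INR _ (Nat.lt_0_succ n))).
  rewrite glaisher_seq_step in Hs by exact HB.
  enough (0 < (-1) ^ 2 * (glaisher_seq (S n) - glaisher_seq (S (S n)))) by lra.
  apply Hs. intros t Ht. apply (inv_derivative_even_pos 1).
  pose proof (pos_INR (S n)); lra.
- intros n.
  assert (H : glaisher_seq 1 + b / INR 1 ^ 2 <= glaisher_seq (S n) + b / INR (S n) ^ 2).
  { induction n as [|n IH]; [lra|]. eapply Rle_trans; [exact IH|].
    specialize (Hs 2%nat (INR (S n)) (lt_0_INR _ (Nat.lt_0_succ n))).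
    assert (E : em_step B t_ln_chain 2 (INR (S n))
      = em_step B t_ln_chain 1 (INR (S n))
        + b * (t_ln_chain 4 (INR (S n) + 1) - t_ln_chain 4 (INR (S n)))).
    { unfold em_step. rewrite (sum_n_Sm _ 1 1) by lia.
      change (@plus _) with Rplus. rewrite <- Rplus_assoc. reflexivity. }
    rewrite E, glaisher_seq_step, <- S_INR in Hs by exact HB.
    unfold t_ln_chain, inv_derivative in Hs.
    enough (0 < (-1) ^ 3 * (glaisher_seq (S n) - glaisher_seq (S (S n)) +
        b * ((-1) ^ 1 * INR (fact 1) / INR (S (S n)) ^ 2 -
         (-1) ^ 1 * INR (fact 1) / INR (S n) ^ 2))) as H.
    { simpl pow in H at 1 2 4. simpl (INR (fact 1)) in H. unfold Rdiv in *.
      revert H. generalize (/ INR (S n) ^ 2) (/ INR (S (S n)) ^ 2).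
      intros; lra. }
    apply Hs. intros t Ht. apply (inv_derivative_even_pos 2).
    pose proof (pos_INR (S n)); lra. }
  assert (H1 : 1 <= INR (S n) ^ 2).
  { apply pow_R1_Rle. rewrite S_INR. pose proof (pos_INR n); lra. }
  assert (b / INR (S n) ^ 2 <= Rabs b).
  { apply Rle_trans with (Rabs (b / INR (S n) ^ 2)); [apply Rle_abs|].
    unfold Rdiv. rewrite Rabs_mult, Rabs_inv, (Rabs_pos_eq (_ ^ 2)) by lra.
    rewrite <- (Rmult_1_r (Rabs b)) at 2.
    apply Rmult_le_compat_l; [apply Rabs_pos|].
    rewrite <- Rinv_1. apply Rinv_le_contravar; lra. }
  replace (INR 1 ^ 2) with 1 in H by (simpl; ring). lra.
Qed.

Lemma ln_succ_bounds (n : nat) : (1 <= n)%nat ->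
  / INR (S n) <= ln (INR (S n)) - ln (INR n) <= / INR n.
Proof.
intros Hn. pose proof (lt_0_INR n ltac:(lia)). pose proof (lt_0_INR (S n) ltac:(lia)).
rewrite <- ln_div by assumption. split.
- assert (E : ln (INR (S n) / INR n) = - ln (INR n / INR (S n))).
  { rewrite !ln_div by assumption. ring. }
  rewrite E. pose proof (ln_le_sub_1 (INR n / INR (S n))
    ltac:(apply Rdiv_lt_0_compat; assumption)).
  replace (/ INR (S n)) with (1 - INR n / INR (S n)); [lra|].
  rewrite S_INR in *. field. lra.
- pose proof (ln_le_sub_1 (INR (S n) / INR n)
    ltac:(apply Rdiv_lt_0_compat; assumption)).
  replace (/ INR n) with (INR (S n) / INR n - 1); [lra|].
  rewrite S_INR. field. lra.
Qed.

Definition harmonic (n : nat) : R := sum_n_m (fun i => / INR i) 1 n.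

Lemma harmonic_lim :
  is_lim_seq (fun n => harmonic n - ln (INR n)) euler_gamma.
Proof.
apply Lim_seq_correct'.
destruct (ex_finite_lim_seq_decr (fun n => harmonic (S n) - ln (INR (S n))) 0) as [l Hl].
- intros n. unfold harmonic. rewrite (sum_n_Sm _ 1 (S n)) by lia.
  change (@plus _) with Rplus. pose proof (ln_succ_bounds (S n) ltac:(lia)). lra.
- intros n. enough (ln (INR (S (S n))) <= harmonic (S n)).
  { pose proof (ln_succ_bounds (S n) ltac:(lia)).
    assert (0 < / INR (S (S n))) by (apply Rinv_0_lt_compat, lt_0_INR; lia). lra. }
  induction n as [|n IH].
  + unfold harmonic. rewrite sum_n_n. simpl. pose proof (ln_le_sub_1 (1 + 1) ltac:(lra)). lra.
  + unfold harmonic in *. rewrite (sum_n_Sm _ 1 (S n)) by lia.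
    change (@plus _) with Rplus. pose proof (ln_succ_bounds (S (S n)) ltac:(lia)). lra.
- exists l. now apply (is_lim_seq_incr_1 (fun n => harmonic n - ln (INR n))).
Qed.

(** * Alternating sums regularised by Euler's transformation *)

Definition diff3 (g : R -> R) (t : R) : R :=
  g (t + 3) - 3 * g (t + 2) + 3 * g (t + 1) - g t.

(** The first three terms of Euler's transformation of the alternating sum
    [g t - g (t+1) + g (t+2) - ...]. *)
Definition euler_bd (g : R -> R) (t : R) : R :=
  g t / 2 - (g (t + 1) - g t) / 4 + (g (t + 2) - 2 * g (t + 1) + g t) / 8.

(** Euler's transformation of [g 1 - g 2 + g 3 - ...].  Third differences are
    needed because those of [t^(-s)] decay like [t^(-s-3)], which is summable in a
    neighbourhood of [s = -1]. *)
Definition alt_sum (g : R -> R) : R :=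
  euler_bd g 1 - Series (fun n => (-1) ^ n * diff3 g (INR n + 1)) / 8.

Lemma alt_partial_sum (g : R -> R) (N : nat) :
  sum_n (fun i => (-1) ^ i * g (INR i + 1)) N
  = euler_bd g 1 + (-1) ^ N * euler_bd g (INR N + 2)
    - sum_n (fun i => (-1) ^ i * diff3 g (INR i + 1)) N / 8.
Proof.
eqR. unfold euler_bd, diff3. induction N as [|N IH].
- rewrite !sum_O. simpl INR. simpl pow.
  replace (0 + 1) with 1 by ring. replace (0 + 2) with (1 + 1) by ring.
  replace (1 + 1 + 1) with (1 + 2) by ring. replace (1 + 1 + 2) with (1 + 3) by ring.
  field.
- rewrite !sum_n_succ, IH. rewrite S_INR.
  replace (INR N + 1 + 1) with (INR N + 2) by ring.
  replace (INR N + 1 + 2) with (INR N + 2 + 1) by ring.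
  replace (INR N + 1 + 3) with (INR N + 2 + 2) by ring.
  replace (INR N + 2 + 1 + 1) with (INR N + 2 + 2) by ring.
  replace (INR N + 2 + 1 + 2) with (INR N + 2 + 3) by ring.
  simpl pow. field.
Qed.

(** If [g] does not tend to 0 the partial sums oscillate; the terms of Euler's
    transformation at the endpoint compensate for this. *)
Lemma alt_sum_lim (g : R -> R) :
  ex_series (fun n => (-1) ^ n * diff3 g (INR n + 1)) ->
  is_lim_seq (fun N => sum_n (fun i => (-1) ^ i * g (INR i + 1)) N
                       - (-1) ^ N * euler_bd g (INR N + 2)) (alt_sum g).
Proof.
intros H. apply Series_correct in H.
apply is_lim_seq_ext with (fun N => euler_bd g 1
    - sum_n (fun i => (-1) ^ i * diff3 g (INR i + 1)) N * / 8).
{ intros N. eqR. rewrite (alt_partial_sum g). unfold Rdiv; ring. }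
apply is_lim_seq_minus'; [apply is_lim_seq_const|].
apply is_lim_seq_mult'; [exact H|apply is_lim_seq_const].
Qed.

Lemma alt_sum_ext (f g : R -> R) :
  (forall t, 1 <= t -> f t = g t) -> alt_sum f = alt_sum g.
Proof.
intros H. unfold alt_sum, euler_bd.
rewrite (Series_ext _ (fun n => (-1) ^ n * diff3 g (INR n + 1))).
- rewrite !H by lra. reflexivity.
- intros n. unfold diff3. pose proof (pos_INR n). rewrite !H by lra. reflexivity.
Qed.

(** The relation [1 - 2 + 3 - ... = (1 + 2 + 3 + ...) - 2 (2 + 4 + ...)], which in
    the case of [n^(-s)] produces the factor [1 - 2^(1-s)]. *)
Lemma alt_sum_split (g : R -> R) (N : nat) :
  sum_n (fun i => (-1) ^ i * g (INR i + 1)) (2 * N + 1)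
  = sum_n (fun i => g (INR (S i))) (2 * N + 1)
    - 2 * sum_n (fun i => g (2 * INR (S i))) N.
Proof.
eqR. induction N as [|N IH].
- simpl (2 * 0 + 1)%nat. rewrite !sum_n_succ, !sum_O. simpl.
  replace (2 * 1) with (1 + 1) by ring. replace (0 + 1) with 1 by ring. ring.
- replace (2 * S N + 1)%nat with (S (S (2 * N + 1))) by lia.
  rewrite (sum_n_succ _ (S _)), (sum_n_succ _ (2 * N + 1)), IH.
  rewrite (sum_n_succ _ (S (2 * N + 1))), (sum_n_succ _ (2 * N + 1)), (sum_n_succ _ N).
  rewrite <- !S_INR.
  replace (2 * INR (S (S N))) with (INR (S (S (S (2 * N + 1))))).
  2: { rewrite !S_INR, plus_INR, mult_INR. simpl. ring. }
  assert (E : (-1) ^ S (2 * N + 1) = 1).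
  { replace (S (2 * N + 1)) with (2 * (N + 1))%nat by lia. apply pow_1_even. }
  change ((-1) ^ S (S (2 * N + 1))) with (-1 * (-1) ^ S (2 * N + 1)).
  rewrite E. ring.
Qed.

(** Regularised sums may be expanded termwise as soon as the third differences
    of the coefficients satisfy Cauchy estimates summable in [n]. *)
Lemma alt_sum_pseries (p : nat -> R -> R) (g : R -> R) (v : nat -> R) (rho u : R) :
  Rabs u < rho -> ex_series v ->
  (forall n m, Rabs (diff3 (p m) (INR n + 1)) * rho ^ m <= v n) ->
  (forall t, 1 <= t -> is_series (fun m => p m t * u ^ m) (g t)) ->
  is_pseries (fun m => alt_sum (p m)) u (alt_sum g).
Proof.
intros Hu Hv Hp Hg. apply is_pseries_R_iff.
pose proof (Rabs_pos u) as Hu0.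
assert (Hb : is_series (fun m => euler_bd (p m) 1 * u ^ m) (euler_bd g 1)).
{ unfold euler_bd.
  (* 7/8, -1/2 and 1/8 are the weights of [g 1], [g 2], [g 3] in [euler_bd g 1] *)
  apply is_series_ext with (fun m => 7 / 8 * (p m 1 * u ^ m)
     + - / 2 * (p m (1 + 1) * u ^ m) + / 8 * (p m (1 + 2) * u ^ m)).
  { intros m. eqR. field. }
  evar_last.
  - apply is_series_Rplus; [apply is_series_Rplus|];
      apply is_series_Rmult; apply Hg; lra.
  - field. }
set (q := Rabs u / rho).
assert (Hq : 0 <= q < 1).
{ unfold q. split; [apply Rdiv_le_0_compat; lra|].
  apply Rmult_lt_reg_r with rho; [lra|]. unfold Rdiv.
  rewrite Rmult_assoc, Rinv_l; lra. }
set (a := fun n m => (-1) ^ n * diff3 (p m) (INR n + 1) * u ^ m).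
assert (Ha : forall n m, Rabs (a n m) <= v n * q ^ m).
{ intros n m. unfold a. rewrite !Rabs_mult, pow_1_abs, Rmult_1_l, <- RPow_abs.
  replace (Rabs u) with (rho * q) by (unfold q; field; lra).
  rewrite Rpow_mult_distr, <- Rmult_assoc.
  apply Rmult_le_compat_r; [now apply pow_le|apply Hp]. }
pose proof (is_series_swap a v q Hq Hv Ha) as Hs.
apply is_series_ext with (fun m => euler_bd (p m) 1 * u ^ m
   + - / 8 * Series (fun n => a n m)).
{ intros m. eqR. unfold alt_sum, a. rewrite Series_scal_r. unfold Rdiv; ring. }
evar_last.
- apply is_series_Rplus; [exact Hb|].
  apply is_series_Rmult; exact Hs.
- unfold alt_sum.
  rewrite (Series_ext (fun n => Series (a n)) (fun n => (-1) ^ n * diff3 g (INR n + 1))).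
  + unfold Rdiv; ring.
  + intros n. apply is_series_unique. unfold a.
    apply is_series_ext with (fun m => (-1) ^ n * (diff3 (p m) (INR n + 1) * u ^ m)).
    { intros m; eqR; ring. }
    apply is_series_Rmult.
    unfold diff3. pose proof (pos_INR n).
    apply is_series_ext with (fun m => p m (INR n + 1 + 3) * u ^ m
       + -3 * (p m (INR n + 1 + 2) * u ^ m) + 3 * (p m (INR n + 1 + 1) * u ^ m)
       + -1 * (p m (INR n + 1) * u ^ m)).
    { intros m. eqR. ring. }
    evar_last.
    * apply is_series_Rplus; [apply is_series_Rplus; [apply is_series_Rplus|]|].
      -- apply Hg; lra.
      -- apply is_series_Rmult; apply Hg; lra.
      -- apply is_series_Rmult; apply Hg; lra.
      -- apply is_series_Rmult; apply Hg; lra.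
    * ring.
Qed.

(** * Third differences of powers *)

(** Up to sign, [ptrig x y m 1 0 t] is the [m]-th Taylor coefficient at [x] of the
    function [u -> Re (t^(-u-iy))].  General [a] and [b] make the family stable
    under differentiation in [t]. *)
Definition ptrig (x y : R) (m : nat) (a b t : R) : R :=
  exp (- x * ln t) * (ln t ^ m / INR (fact m))
  * (a * cos (y * ln t) + b * sin (y * ln t)).

Fixpoint nth_derivative (d : nat) (f h : R -> R) : Prop :=
  match d with
  | 0%nat => forall t, 0 < t -> f t = h t
  | S d' => exists f' : R -> R, (forall t, 0 < t -> is_derive f t (f' t))
              /\ nth_derivative d' f' h
  end.

Lemma nth_derivative_plus (d : nat) (f1 f2 h1 h2 : R -> R) :
  nth_derivative d f1 h1 -> nth_derivative d f2 h2 ->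
  nth_derivative d (fun t => f1 t + f2 t) (fun t => h1 t + h2 t).
Proof.
revert f1 f2; induction d as [|d IH]; simpl; intros f1 f2 H1 H2.
- intros t Ht; now rewrite H1, H2.
- destruct H1 as [f1' [D1 H1]], H2 as [f2' [D2 H2]].
  exists (fun t => f1' t + f2' t); split.
  + intros t Ht. apply @is_derive_plus; auto.
  + now apply IH.
Qed.

Lemma exp_neg_shift (x t : R) : 0 < t -> exp (- (x + 1) * ln t) = exp (- x * ln t) / t.
Proof.
intros Ht. replace (- (x + 1) * ln t) with (- x * ln t + - ln t) by ring.
rewrite exp_plus, exp_Ropp, exp_ln by exact Ht. reflexivity.
Qed.

Lemma is_derive_ptrig_0 (x y a b t : R) : 0 < t ->
  is_derive (ptrig x y 0 a b) t
    (ptrig (x + 1) y 0 (- x * a + y * b) (- x * b - y * a) t).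
Proof.
intros Ht. unfold ptrig. rewrite exp_neg_shift by exact Ht.
auto_derive; [tauto|]. simpl. field. lra.
Qed.

Lemma is_derive_ptrig_S (x y : R) (m : nat) (a b t : R) : 0 < t ->
  is_derive (ptrig x y (S m) a b) t
    (ptrig (x + 1) y (S m) (- x * a + y * b) (- x * b - y * a) t
     + ptrig (x + 1) y m a b t).
Proof.
intros Ht. unfold ptrig. rewrite exp_neg_shift by exact Ht.
pose proof (INR_fact_neq_0 m). pose proof (not_0_INR (S m) ltac:(lia)) as HS.
rewrite fact_simpl, mult_INR.
auto_derive; [tauto|].
rewrite S_INR in *.
change (match m with 0%nat => 1 | S _ => INR m + 1 end) with (INR (S m)).
rewrite ?S_INR. rewrite <- tech_pow_Rmult. field. repeat split; auto; lra.
Qed.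

Lemma pow_div_fact_le_exp (z : R) (m : nat) : 0 <= z -> z ^ m / INR (fact m) <= exp z.
Proof.
intros Hz. eapply Rle_trans; [|now apply (exp_ge_taylor z m)].
destruct m as [|m]; [simpl; lra|].
rewrite tech5.
assert (0 <= sum_f_R0 (fun k => z ^ k / INR (fact k)) m); [|lra].
apply cond_pos_sum. intros k. apply Rdiv_le_0_compat; [now apply pow_le|apply INR_fact_lt_0].
Qed.

(** Cauchy-type estimates, uniform in [m]: each differentiation in [t] gains a
    factor [1/t], and the factor [(ln t)^m / m!] costs at most [t^r / r^m]. *)
Lemma ptrig_derivative_bound (d : nat) (y r : R) : 0 < r -> forall x M, 0 <= M ->
  exists K, 0 <= K /\ forall m a b, Rabs a <= M -> Rabs b <= M ->
    exists h, nth_derivative d (ptrig x y m a b) h /\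
      forall t, 1 <= t -> Rabs (h t) * r ^ m <= K * exp ((r - x - INR d) * ln t).
Proof.
intros Hr; induction d as [|d IH]; intros x M HM.
- exists (2 * M); split; [lra|]. intros m a b Ha Hb.
  exists (ptrig x y m a b); split; [simpl; auto|]. intros t Ht.
  pose proof (ln_ge_0 t Ht) as HL. unfold ptrig. set (L := ln t) in *.
  assert (H1 : Rabs (a * cos (y * L) + b * sin (y * L)) <= 2 * M).
  { eapply Rle_trans; [apply Rabs_triang|]. rewrite !Rabs_mult.
    assert (Rabs (cos (y * L)) <= 1) by (apply Rabs_le, COS_bound).
    assert (Rabs (sin (y * L)) <= 1) by (apply Rabs_le, SIN_bound).
    pose proof (Rabs_pos (cos (y * L))). pose proof (Rabs_pos (sin (y * L))).
    pose proof (Rabs_pos a). pose proof (Rabs_pos b). nra. }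
  pose proof (pow_div_fact_le_exp (r * L) m ltac:(apply Rmult_le_pos; lra)) as H2.
  assert (H3 : 0 <= L ^ m / INR (fact m)).
  { apply Rdiv_le_0_compat; [now apply pow_le|apply INR_fact_lt_0]. }
  rewrite !Rabs_mult, (Rabs_pos_eq (exp _)) by apply Rlt_le, exp_pos.
  rewrite (Rabs_pos_eq (L ^ m / _)) by exact H3.
  replace (exp ((r - x - INR 0) * L)) with (exp (- x * L) * exp (r * L))
    by (rewrite <- exp_plus; f_equal; simpl; ring).
  rewrite Rpow_mult_distr in H2.
  transitivity (exp (- x * L) * (r ^ m * L ^ m / INR (fact m)) * (2 * M)).
  + replace (exp (- x * L) * (L ^ m / INR (fact m))
      * Rabs (a * cos (y * L) + b * sin (y * L)) * r ^ m)
      with (exp (- x * L) * (r ^ m * L ^ m / INR (fact m))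
        * Rabs (a * cos (y * L) + b * sin (y * L))) by (unfold Rdiv; ring).
    apply Rmult_le_compat_l; [|exact H1].
    apply Rmult_le_pos; [apply Rlt_le, exp_pos|].
    apply Rdiv_le_0_compat; [|apply INR_fact_lt_0].
    apply Rmult_le_pos; apply pow_le; lra.
  + rewrite (Rmult_comm (2 * M)). apply Rmult_le_compat_r; [lra|].
    apply Rmult_le_compat_l; [apply Rlt_le, exp_pos|exact H2].
- set (M' := (Rabs x + Rabs y + 1) * M).
  pose proof (Rabs_pos x) as Hx0. pose proof (Rabs_pos y) as Hy0.
  assert (HMM' : M <= M') by (unfold M'; nra).
  destruct (IH (x + 1) M' ltac:(lra)) as [K [HK HB]].
  exists (K + r * K); split; [nra|]. intros m a b Ha Hb.
  assert (Ha' : Rabs (- x * a + y * b) <= M').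
  { eapply Rle_trans; [apply Rabs_triang|]. rewrite !Rabs_mult, Rabs_Ropp.
    pose proof (Rabs_pos a). pose proof (Rabs_pos b). unfold M'. nra. }
  assert (Hb' : Rabs (- x * b - y * a) <= M').
  { eapply Rle_trans; [apply Rabs_triang|].
    rewrite Rabs_Ropp, !Rabs_mult, Rabs_Ropp.
    pose proof (Rabs_pos a). pose proof (Rabs_pos b). unfold M'. nra. }
  assert (He : forall t, (r - (x + 1) - INR d) * ln t = (r - x - INR (S d)) * ln t).
  { intros t. rewrite S_INR. ring. }
  destruct (HB m _ _ Ha' Hb') as [h1 [D1 B1]].
  assert (Hpos : forall t, 0 <= K * exp ((r - x - INR (S d)) * ln t)).
  { intros t. apply Rmult_le_pos; [exact HK|apply Rlt_le, exp_pos]. }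
  destruct m as [|m].
  + exists h1; split.
    * simpl. eexists; split; [intros t Ht; now apply is_derive_ptrig_0|exact D1].
    * intros t Ht. specialize (B1 t Ht). rewrite He in B1. specialize (Hpos t). nra.
  + destruct (HB m a b ltac:(lra) ltac:(lra)) as [h2 [D2 B2]].
    exists (fun t => h1 t + h2 t); split.
    * simpl. eexists; split; [intros t Ht; now apply is_derive_ptrig_S|].
      now apply nth_derivative_plus.
    * intros t Ht. specialize (B1 t Ht). specialize (B2 t Ht).
      rewrite He in B1, B2.
      eapply Rle_trans; [apply Rmult_le_compat_r; [apply pow_le; lra|apply Rabs_triang]|].
      rewrite Rmult_plus_distr_r, (Rmult_plus_distr_r K), (Rmult_assoc r K).
      apply Rplus_le_compat; [exact B1|].
      simpl pow. replace (Rabs (h2 t) * (r * r ^ m)) with (r * (Rabs (h2 t) * r ^ m)) by ring.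
      apply Rmult_le_compat_l; [lra|exact B2].
Qed.

Lemma increment_bound (f f' : R -> R) (t M : R) :
  (forall s, t <= s <= t + 1 -> is_derive f s (f' s)) ->
  (forall s, t <= s <= t + 1 -> Rabs (f' s) <= M) -> Rabs (f (t + 1) - f t) <= M.
Proof.
intros Hd Hb. destruct (MVT_is_derive f f' t (t + 1) ltac:(lra) Hd) as [c [Hc E]].
rewrite E. replace (t + 1 - t) with 1 by ring. rewrite Rmult_1_r. apply Hb; lra.
Qed.

Lemma is_derive_increment (f f' : R -> R) (s : R) :
  (forall t, 0 < t -> is_derive f t (f' t)) -> 0 < s ->
  is_derive (fun u => f (u + 1) - f u) s (f' (s + 1) - f' s).
Proof.
intros H Hs. apply @is_derive_minus; [|now apply H].
evar_last.
- apply (is_derive_comp f (fun u => u + 1)); [apply H; lra|].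
  auto_derive; [trivial|reflexivity].
- unfold scal; simpl; unfold mult; simpl; ring.
Qed.

(** The mean value theorem, applied once for each difference. *)
Lemma diff3_bound (f h : R -> R) (t M : R) : 0 < t -> nth_derivative 3 f h ->
  (forall s, t <= s <= t + 3 -> Rabs (h s) <= M) -> Rabs (diff3 f t) <= M.
Proof.
intros Ht [f1 [D1 [f2 [D2 [f3 [D3 E]]]]]] Hb.
pose proof (is_derive_increment f f1) as I1.
pose proof (is_derive_increment (fun u => f (u + 1) - f u) (fun u => f1 (u + 1) - f1 u)) as I2.
pose proof (is_derive_increment f1 f2) as J1.
replace (diff3 f t) with
  ((fun u => (f (u + 1 + 1) - f (u + 1)) - (f (u + 1) - f u)) (t + 1)
   - (fun u => (f (u + 1 + 1) - f (u + 1)) - (f (u + 1) - f u)) t).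
2: { unfold diff3. replace (t + 3) with (t + 1 + 1 + 1) by ring.
     replace (t + 2) with (t + 1 + 1) by ring. ring. }
apply (increment_bound (fun u => (f (u + 1 + 1) - f (u + 1)) - (f (u + 1) - f u))
  (fun u => (f1 (u + 1 + 1) - f1 (u + 1)) - (f1 (u + 1) - f1 u))).
{ intros s Hs. apply I2; [|lra]. intros u Hu. apply I1; [exact D1|exact Hu]. }
intros s Hs.
apply (increment_bound (fun u => f1 (u + 1) - f1 u) (fun u => f2 (u + 1) - f2 u)).
{ intros s' Hs'. apply J1; [exact D2|lra]. }
intros s' Hs'. apply increment_bound with (f' := f3).
- intros w Hw; apply D3; lra.
- intros w Hw. rewrite E by lra. apply Hb; lra.
Qed.

(** Comparison of the terms with the increments of [t^(-delta)]. *)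
Lemma ex_series_power (delta : R) : 0 < delta ->
  ex_series (fun n => exp (- (1 + delta) * ln (INR n + 1))).
Proof.
intros Hd. set (v := fun n => exp (- (1 + delta) * ln (INR n + 1))).
set (e := fun n => exp (- delta * ln (INR n + 1))).
assert (Hstep : forall n, v (S n) <= / delta * (e n - e (S n))).
{ intros n. unfold v, e. pose proof (pos_INR n). rewrite S_INR.
  destruct (MVT_is_derive (fun t => exp (- delta * ln t))
    (fun t => - delta * exp (- (1 + delta) * ln t)) (INR n + 1) (INR n + 1 + 1))
    as [c [Hc E]]; [lra| |].
  - intros t Ht. replace (1 + delta) with (delta + 1) by ring.
    rewrite exp_neg_shift by lra. auto_derive; [lra|]. field; lra.
  - replace (/ delta * (exp (- delta * ln (INR n + 1)) - exp (- delta * ln (INR n + 1 + 1))))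
      with (exp (- (1 + delta) * ln c)).
    + destruct (Req_dec c (INR n + 1 + 1)) as [->|Hn]; [lra|].
      apply Rlt_le, exp_increasing.
      pose proof (ln_increasing c (INR n + 1 + 1) ltac:(lra) ltac:(lra)). nra.
    + replace (exp (- delta * ln (INR n + 1)) - exp (- delta * ln (INR n + 1 + 1)))
        with (delta * exp (- (1 + delta) * ln c)) by lra. field; lra. }
assert (Hpos : forall n, 0 < v n) by (intros; apply exp_pos).
assert (Hsum : forall N, sum_n v N <= v 0%nat + / delta * (e 0%nat - e N)).
{ induction N as [|N IH].
  - rewrite sum_O. lra.
  - rewrite sum_n_succ. specialize (Hstep N). lra. }
destruct (ex_finite_lim_seq_incr (sum_n v) (v 0%nat + / delta * e 0%nat)) as [l Hl].
- intros n. rewrite sum_n_succ. specialize (Hpos (S n)). lra.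
- intros n. eapply Rle_trans; [apply Hsum|].
  assert (0 < e n) by apply exp_pos. assert (0 < / delta) by now apply Rinv_0_lt_compat.
  nra.
- exists l. exact Hl.
Qed.

(** With [r = (x+2)/2] the third differences are of the order [n^(-1-r)]. *)
Lemma ptrig_diff3_bound (x y : R) : -2 < x ->
  exists v, ex_series v /\ forall n m a b, Rabs a <= 1 -> Rabs b <= 1 ->
    Rabs (diff3 (ptrig x y m a b) (INR n + 1)) * ((x + 2) / 2) ^ m <= v n.
Proof.
intros Hx. set (r := (x + 2) / 2). assert (Hr : 0 < r) by (unfold r; lra).
destruct (ptrig_derivative_bound 3 y r Hr x 1 ltac:(lra)) as [K [HK HB]].
exists (fun n => K * exp (- (1 + r) * ln (INR n + 1))); split.
- apply (ex_series_scal_l K (fun n => exp (- (1 + r) * ln (INR n + 1)))).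
  now apply ex_series_power.
- intros n m a b Ha Hb. destruct (HB m a b Ha Hb) as [h [Dh Bh]].
  pose proof (pos_INR n). assert (Hrm : 0 < r ^ m) by now apply pow_lt.
  apply Rmult_le_reg_r with (/ r ^ m); [now apply Rinv_0_lt_compat|].
  rewrite Rmult_assoc, Rinv_r, Rmult_1_r by lra.
  apply diff3_bound with h; [lra|exact Dh|]. intros s Hs.
  apply Rmult_le_reg_r with (r ^ m); [exact Hrm|].
  rewrite (Rmult_assoc _ (/ r ^ m)), Rinv_l, Rmult_1_r by lra.
  eapply Rle_trans; [apply Bh; lra|]. apply Rmult_le_compat_l; [exact HK|].
  replace (r - x - INR 3) with (- (1 + r)) by (unfold r; simpl; field).
  destruct (Req_dec s (INR n + 1)) as [->|Hn]; [lra|].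
  apply Rlt_le, exp_increasing.
  pose proof (ln_increasing (INR n + 1) s ltac:(lra) ltac:(lra)). nra.
Qed.

Lemma ptrig_ex_series (x y : R) (m : nat) (a b : R) : -2 < x ->
  Rabs a <= 1 -> Rabs b <= 1 ->
  ex_series (fun n => (-1) ^ n * diff3 (ptrig x y m a b) (INR n + 1)).
Proof.
intros Hx Ha Hb. destruct (ptrig_diff3_bound x y Hx) as [v [Hv H]].
set (r := (x + 2) / 2) in *. assert (Hrm : 0 < r ^ m) by (apply pow_lt; unfold r; lra).
apply (ex_series_le (V := R_CompleteNormedModule)) with (fun n => v n * / r ^ m).
- intros n. unfold norm; simpl; unfold abs; simpl.
  rewrite Rabs_mult, pow_1_abs, Rmult_1_l.
  apply Rmult_le_reg_r with (r ^ m); [exact Hrm|].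
  rewrite (Rmult_assoc (v n)), Rinv_l, Rmult_1_r by lra. now apply H.
- now apply ex_series_scal_r.
Qed.

(** Covers motions of [s] in both directions: [G] is an exponential for a
    horizontal one and a cosine for a vertical one. *)
Lemma alt_sum_ptrig_pseries (x y u : R) (eps : nat -> R) (G : R -> R) : -2 < x ->
  (forall m, Rabs (eps m) <= 1) ->
  (forall z, is_series (fun m => eps m * (z ^ m / INR (fact m))) (G z)) ->
  Rabs u < (x + 2) / 2 ->
  is_pseries (fun m => alt_sum (ptrig x y m (eps m) 0)) u
    (alt_sum (fun t => exp (- x * ln t) * cos (y * ln t) * G (u * ln t))).
Proof.
intros Hx He HG Hu. destruct (ptrig_diff3_bound x y Hx) as [v [Hv H]].
apply alt_sum_pseries with v ((x + 2) / 2); auto.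
- intros n m. apply H; [apply He|rewrite Rabs_R0; lra].
- intros t _.
  apply is_series_ext with (fun m => exp (- x * ln t) * cos (y * ln t)
    * (eps m * ((u * ln t) ^ m / INR (fact m)))).
  + intros m. eqR. unfold ptrig. rewrite Rpow_mult_distr. unfold Rdiv; ring.
  + apply is_series_Rmult, HG.
Qed.

(** * The regularised alternating sum of n^(-s) *)

(** [cpow x y t] and [- spow x y t] are the real and imaginary parts of
    [t^(-x-iy)]. *)
Definition cpow (x y t : R) : R := exp (- x * ln t) * cos (y * ln t).

Definition spow (x y t : R) : R := exp (- x * ln t) * sin (y * ln t).

Lemma cpow_double (x y t : R) : 0 < t ->
  cpow x y (2 * t) = cpow x y 2 * cpow x y t - spow x y 2 * spow x y t.
Proof.
intros Ht. unfold cpow, spow. rewrite ln_mult by lra.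
rewrite !Rmult_plus_distr_l, exp_plus, cos_plus. ring.
Qed.

Lemma ptrig_cpow (x y t : R) : ptrig x y 0 1 0 t = cpow x y t.
Proof. unfold ptrig, cpow; simpl. field. Qed.

Lemma cpow_ex_series (x y : R) : -2 < x ->
  ex_series (fun n => (-1) ^ n * diff3 (cpow x y) (INR n + 1)).
Proof.
intros Hx. apply ex_series_ext with
  (fun n => (-1) ^ n * diff3 (ptrig x y 0 1 0) (INR n + 1)).
- intros n. unfold diff3. rewrite !ptrig_cpow. reflexivity.
- apply ptrig_ex_series; [exact Hx| |]; rewrite ?Rabs_R1, ?Rabs_R0; lra.
Qed.

Lemma cpow_lim_0 (x y c : R) : 0 < x -> 0 < c ->
  is_lim_seq (fun n => cpow x y (INR n + c)) 0.
Proof.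
intros Hx Hc. apply is_lim_seq_abs_0.
apply is_lim_seq_le_le with (u := fun _ => 0) (w := fun n => exp (- x * ln (INR n + c))).
- intros n. split; [apply Rabs_pos|]. unfold cpow.
  rewrite Rabs_mult, Rabs_pos_eq by apply Rlt_le, exp_pos.
  rewrite <- (Rmult_1_r (exp _)) at 2. apply Rmult_le_compat_l; [apply Rlt_le, exp_pos|].
  apply Rabs_le, COS_bound.
- apply is_lim_seq_const.
- apply (is_lim_comp_seq exp (fun n => - x * ln (INR n + c)) m_infty 0).
  + apply is_lim_exp_m.
  + exists 0%nat; intros; discriminate.
  + evar_last.
    * apply is_lim_seq_scal_l.
      apply (is_lim_comp_seq ln (fun n => INR n + c) p_infty p_infty).
      -- apply is_lim_ln_p.
      -- exists 0%nat; intros; discriminate.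
      -- apply is_lim_seq_plus with p_infty c;
           [apply is_lim_seq_INR|apply is_lim_seq_const|reflexivity].
    * simpl. destruct (Rle_dec 0 (- x)) as [H|H]; [exfalso; lra|reflexivity].
Qed.

Lemma alt_sum_cpow_pseries (x y h : R) : -2 < x -> Rabs h < (x + 2) / 2 ->
  is_pseries (fun m => alt_sum (ptrig x y m ((-1) ^ m) 0)) h
    (alt_sum (cpow (x + h) y)).
Proof.
intros Hx Hh.
rewrite (alt_sum_ext (cpow (x + h) y)
  (fun t => exp (- x * ln t) * cos (y * ln t) * exp (- (h * ln t)))).
- apply (alt_sum_ptrig_pseries x y h (fun m => (-1) ^ m) (fun z => exp (- z))); auto.
  + intros m. rewrite pow_1_abs; lra.
  + intros z. pose proof (proj1 (is_pseries_R_iff _ _ _) (is_exp_Reals (- z))) as He.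
    revert He. apply is_series_ext. intros m. eqR.
    replace (- z) with (-1 * z) by ring. rewrite Rpow_mult_distr. unfold Rdiv; ring.
- intros t _. unfold cpow.
  replace (- (x + h) * ln t) with (- x * ln t + - (h * ln t)) by ring.
  rewrite exp_plus. ring.
Qed.

Lemma alt_sum_cpow_analytic (x y : R) : -2 < x ->
  real_analytic_at (fun u => alt_sum (cpow u y)) x.
Proof.
intros Hx. eexists; exists ((x + 2) / 2). split; [lra|].
intros h Hh. now apply alt_sum_cpow_pseries.
Qed.

(** In the vertical direction the expansion is that of the cosine. *)
Lemma alt_sum_cpow_continuous (x : R) : -2 < x ->
  continuous (fun y => alt_sum (cpow x y)) 0.
Proof.
intros Hx. apply real_analytic_continuous.
exists (fun m => alt_sum (ptrig x 0 m (cos (INR m * (PI / 2))) 0)), ((x + 2) / 2).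
split; [lra|]. intros h Hh. rewrite Rplus_0_l.
rewrite (alt_sum_ext (cpow x h)
  (fun t => exp (- x * ln t) * cos (0 * ln t) * cos (h * ln t))).
- apply (alt_sum_ptrig_pseries x 0 h (fun m => cos (INR m * (PI / 2))) cos); auto.
  + intros m. apply Rabs_le, COS_bound.
  + apply is_series_cos.
- intros t _. unfold cpow. rewrite Rmult_0_l, cos_0. ring.
Qed.

(** * Zeta along horizontal and vertical lines *)

Lemma is_series_Re_Im (a : nat -> C) (l : C) :
  is_series (K := C_AbsRing) (V := C_NormedModule) a l ->
  is_series (fun n => Re (a n)) (Re l) /\ is_series (fun n => Im (a n)) (Im l).
Proof.
intros H.
assert (HR : forall n, Re (sum_n a n) = sum_n (fun k => Re (a k)) n).
{ induction n as [|n IH]; [now rewrite !sum_O|].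
  rewrite sum_n_succ, <- IH, sum_Sn. reflexivity. }
assert (HI : forall n, Im (sum_n a n) = sum_n (fun k => Im (a k)) n).
{ induction n as [|n IH]; [now rewrite !sum_O|].
  rewrite sum_n_succ, <- IH, sum_Sn. reflexivity. }
destruct l as [lr li]. split.
- apply (filterlim_ext (fun n => Re (sum_n a n))); [exact HR|].
  apply (filterlim_comp _ _ _ (sum_n a) fst eventually (locally (lr, li))); [exact H|].
  apply (continuous_fst lr li).
- apply (filterlim_ext (fun n => Im (sum_n a n))); [exact HI|].
  apply (filterlim_comp _ _ _ (sum_n a) snd eventually (locally (lr, li))); [exact H|].
  apply (continuous_snd lr li).
Qed.

Lemma pow_n_RtoC_mult (h : R) (v : C) (n : nat) :
  pow_n (K := C_AbsRing) (RtoC h * v)%C n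
  = (RtoC (h ^ n) * pow_n (K := C_AbsRing) v n)%C.
Proof.
induction n as [|n IH]; simpl.
- unfold one; simpl. unfold RtoC, Cmult; simpl. f_equal; ring.
- rewrite IH. unfold mult; simpl. unfold RtoC, Cmult; simpl. f_equal; ring.
Qed.

(** Restricted to a real line, a complex power series has real and imaginary
    parts that are real power series; only these are ever continued. *)
Lemma analytic_along_line (f : C -> C) (s0 v : C) : Cmod v = 1 -> analytic_at f s0 ->
  real_analytic_at (fun h => Re (f (s0 + RtoC h * v)%C)) 0 /\
  real_analytic_at (fun h => Im (f (s0 + RtoC h * v)%C)) 0.
Proof.
intros Hv [a [r [Hr Ha]]].
assert (H : forall h, Rabs h < r ->
  is_series (fun n => Re (pow_n (K := C_AbsRing) v n * a n)%C * h ^ n)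
     (Re (f (s0 + RtoC h * v)%C)) /\
  is_series (fun n => Im (pow_n (K := C_AbsRing) v n * a n)%C * h ^ n)
     (Im (f (s0 + RtoC h * v)%C))).
{ intros h Hh. specialize (Ha (s0 + RtoC h * v)%C).
  assert (E : (s0 + RtoC h * v - s0)%C = (RtoC h * v)%C) by ring.
  rewrite E, Cmod_mult, Hv, Cmod_R, Rmult_1_r in Ha. specialize (Ha Hh).
  apply is_series_Re_Im in Ha. destruct Ha as [HR HI]. split.
  - revert HR. apply is_series_ext. intros n. eqR. rewrite pow_n_RtoC_mult.
    unfold scal; simpl. unfold mult; simpl. ring.
  - revert HI. apply is_series_ext. intros n. eqR. rewrite pow_n_RtoC_mult.
    unfold scal; simpl. unfold mult; simpl. ring. }
split; eexists; exists r; (split; [exact Hr|]); intros h Hh; rewrite Rplus_0_l;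
  apply is_pseries_R_iff; apply H; exact Hh.
Qed.

Section Zeta.
Variable zeta : C -> C.
Hypothesis Hzeta : is_riemann_zeta zeta.

Lemma zeta_dirichlet (x y : R) : 1 < x ->
  is_series (fun n => cpow x y (INR (S n))) (Re (zeta (x, y))) /\
  is_series (fun n => - spow x y (INR (S n))) (Im (zeta (x, y))).
Proof.
intros Hx. destruct (is_series_Re_Im _ _ (proj1 Hzeta (x, y) Hx)) as [HR HI]. split.
- revert HR. apply is_series_ext. intros n. eqR. unfold cpow, Cexp.
  set (L := ln (INR (S n))). unfold RtoC, Cmult, Copp; simpl. f_equal.
  + f_equal; ring.
  + replace (- x * 0 + - y * L) with (- (y * L)) by ring. apply cos_neg.
- revert HI. apply is_series_ext. intros n. eqR. unfold spow, Cexp.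
  set (L := ln (INR (S n))). unfold RtoC, Cmult, Copp; simpl.
  replace (- x * 0 + - y * L) with (- (y * L)) by ring. rewrite sin_neg.
  replace (- x * L - - y * 0) with (- x * L) by ring. ring.
Qed.

Lemma zeta_analytic_horizontal (x y : R) : (x, y) <> RtoC 1 ->
  real_analytic_at (fun u => Re (zeta (u, y))) x /\
  real_analytic_at (fun u => Im (zeta (u, y))) x.
Proof.
intros H.
destruct (analytic_along_line zeta (x, y) (RtoC 1)) as [[a [r [Hr Ha]]] [b [s [Hs Hb]]]].
- rewrite Cmod_R; apply Rabs_R1.
- now apply (proj2 Hzeta).
- assert (E : forall h, ((x, y) + RtoC (0 + h) * RtoC 1)%C = (x + h, y)).
  { intros h. unfold RtoC, Cmult, Cplus; simpl. f_equal; ring. }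
  split; [exists a, r|exists b, s]; (split; [assumption|]); intros h Hh;
    rewrite <- E; auto.
Qed.

Lemma zeta_continuous_vertical (x : R) : x <> 1 ->
  continuous (fun y => Re (zeta (x, y))) 0 /\
  continuous (fun y => Im (zeta (x, y))) 0.
Proof.
intros H.
destruct (analytic_along_line zeta (x, 0) Ci) as [HR HI].
- unfold Cmod, Ci; simpl. rewrite !Rmult_1_r, Rmult_0_l, Rplus_0_l. apply sqrt_1.
- apply (proj2 Hzeta). intros E. apply H. now injection E.
- assert (E : forall h, ((x, 0) + RtoC h * Ci)%C = (x, h)).
  { intros h. unfold RtoC, Cmult, Cplus, Ci; simpl. f_equal; ring. }
  split; apply real_analytic_continuous.
  + refine (real_analytic_ext _ _ _ _ HR). intros h; now rewrite E.
  + refine (real_analytic_ext _ _ _ _ HI). intros h; now rewrite E.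
Qed.

(** The complex derivative is defined by a limit along the real direction. *)
Lemma zeta_derive_at (x : R) : x <> 1 ->
  is_derive (fun u => Re (zeta (u, 0))) x (Re (C_derive zeta (RtoC x))).
Proof.
intros Hx. destruct (zeta_analytic_horizontal x 0) as [[a [r [Hr Ha]]] _].
{ intros E. apply Hx. now injection E. }
pose proof (real_analytic_derive (fun u => Re (zeta (u, 0))) x r a Hr Ha) as Hd.
replace (Re (C_derive zeta (RtoC x))) with (a 1%nat); [exact Hd|].
change (Re (C_derive zeta (RtoC x))) with
  (real (Lim (fun u => fst ((zeta (u, 0%R) - zeta (RtoC x)) / ((u, 0%R) - RtoC x))%C) x)).
assert (Hl : is_lim (fun u => fst ((zeta (u, 0%R) - zeta (RtoC x)) / ((u, 0%R) - RtoC x))%C)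
  x (a 1%nat)).
{ apply is_derive_Reals in Hd.
  assert (Hu : forall eps : posreal, exists delta : posreal, forall u : R,
    Rabs (u - x) < delta -> u <> x ->
    Rabs (fst ((zeta (u, 0%R) - zeta (RtoC x)) / ((u, 0%R) - RtoC x))%C - a 1%nat) < eps).
  { intros eps. destruct (Hd eps (cond_pos eps)) as [delta Hdelta].
    exists delta. intros u Hu Hne.
    specialize (Hdelta (u - x) ltac:(lra) Hu).
    replace (x + (u - x)) with u in Hdelta by ring.
    replace (fst ((zeta (u, 0%R) - zeta (RtoC x)) / ((u, 0%R) - RtoC x))%C)
      with ((Re (zeta (u, 0)) - Re (zeta (x, 0))) / (u - x)); [exact Hdelta|].
    unfold RtoC. destruct (zeta (u, 0)) as [p q]. destruct (zeta (x, 0)) as [p' q'].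
    unfold Cdiv, Cinv, Cmult, Cminus, Cplus, Copp, Re; simpl. field. lra. }
  apply is_lim_spec. intros eps. destruct (Hu eps) as [delta Hdelta].
  exists delta. exact Hdelta. }
apply is_lim_unique in Hl. rewrite Hl. reflexivity.
Qed.

(** The real part of [(1 - 2^(1-s)) zeta(s)]. *)
Definition eta_re (x y : R) : R :=
  (1 - 2 * cpow x y 2) * Re (zeta (x, y)) - 2 * spow x y 2 * Im (zeta (x, y)).

(** Here the Dirichlet series converges, and the endpoint terms of Euler's
    transformation tend to 0. *)
Lemma eta_right (x y : R) : 1 < x -> eta_re x y = alt_sum (cpow x y).
Proof.
intros Hx. destruct (zeta_dirichlet x y Hx) as [HR HI].
assert (Hbd : is_lim_seq (fun N => (-1) ^ N * euler_bd (cpow x y) (INR N + 2)) 0).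
{ apply is_lim_seq_abs_0.
  apply is_lim_seq_ext with (fun N => Rabs (euler_bd (cpow x y) (INR N + 2))).
  { intros N. now rewrite Rabs_mult, pow_1_abs, Rmult_1_l. }
  evar_last.
  - apply (is_lim_seq_abs _ 0).
    apply is_lim_seq_ext with (fun N => 7 / 8 * cpow x y (INR N + 2)
      + - / 2 * cpow x y (INR N + 3) + / 8 * cpow x y (INR N + 4)).
    { intros N. unfold euler_bd. replace (INR N + 2 + 1) with (INR N + 3) by ring.
      replace (INR N + 2 + 2) with (INR N + 4) by ring. field. }
    evar_last.
    + apply is_lim_seq_plus'; [apply is_lim_seq_plus'|];
        (apply is_lim_seq_mult'; [apply is_lim_seq_const|apply cpow_lim_0; lra]).
    + apply f_equal; ring.
  - simpl. now rewrite Rabs_R0. }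
pose proof (alt_sum_lim _ (cpow_ex_series x y ltac:(lra))) as H1.
pose proof (is_lim_seq_plus' _ _ _ _ H1 Hbd) as H2.
assert (Hsub : filterlim (fun N => (2 * N + 1)%nat) eventually eventually).
{ apply eventually_subseq; intros; lia. }
assert (H3 : is_lim_seq (fun N => sum_n (fun i => (-1) ^ i * cpow x y (INR i + 1)) (2 * N + 1))
   (alt_sum (cpow x y) + 0)).
{ apply (is_lim_seq_subseq (fun N => sum_n (fun i => (-1) ^ i * cpow x y (INR i + 1)) N)
    _ (fun N => (2 * N + 1)%nat)); [exact Hsub|].
  revert H2. apply is_lim_seq_ext. intros N. eqR. ring. }
assert (H4 : is_lim_seq (fun N => sum_n (fun i => (-1) ^ i * cpow x y (INR i + 1)) (2 * N + 1))
   (Re (zeta (x, y)) - 2 * (cpow x y 2 * Re (zeta (x, y)) + spow x y 2 * Im (zeta (x, y))))).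
{ apply is_lim_seq_ext with (fun N => sum_n (fun i => cpow x y (INR (S i))) (2 * N + 1)
    - 2 * sum_n (fun i => cpow x y (2 * INR (S i))) N).
  { intros N. symmetry. apply alt_sum_split. }
  apply is_lim_seq_minus'.
  - apply (is_lim_seq_subseq (sum_n (fun i => cpow x y (INR (S i))))
      _ (fun N => (2 * N + 1)%nat)); [exact Hsub|exact HR].
  - apply is_lim_seq_mult'; [apply is_lim_seq_const|].
    assert (Hs := is_series_Rplus _ _ _ _ (is_series_Rmult (cpow x y 2) _ _ HR)
      (is_series_Rmult (spow x y 2) _ _ HI)).
    refine (is_series_ext _ _ _ _ Hs). intros n. eqR.
    rewrite cpow_double by (apply lt_0_INR; lia). ring. }
apply is_lim_seq_unique in H3. apply is_lim_seq_unique in H4.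
rewrite H3 in H4. injection H4 as E. unfold eta_re. lra.
Qed.

(** On a horizontal line that misses the pole the identity theorem applies. *)
Lemma eta_off_axis (x y : R) : y <> 0 -> -2 < x -> eta_re x y = alt_sum (cpow x y).
Proof.
intros Hy Hx. apply Rminus_diag_uniq.
apply (real_analytic_zero (fun u => eta_re u y - alt_sum (cpow u y)) (-2) 1); [| |exact Hx].
- intros u Hu.
  destruct (zeta_analytic_horizontal u y) as [HR HI].
  { intros E. apply Hy. now injection E. }
  (* [cpow w y 2] and [spow w y 2] with their dependence on [w] made exponential;
     the factor [exp (- w * 0)] is 1 *)
  apply real_analytic_ext with (fun w => Re (zeta (w, y))
    + (- 2 * cos (y * ln 2) * exp (- w * ln 2)) * Re (zeta (w, y))
    + (- 2 * sin (y * ln 2) * exp (- w * ln 2)) * Im (zeta (w, y))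
    + (- 1 * exp (- w * 0)) * alt_sum (cpow w y)).
  { intros w. unfold eta_re. rewrite Rmult_0_r, exp_0.
    change (cpow w y 2) with (exp (- w * ln 2) * cos (y * ln 2)).
    change (spow w y 2) with (exp (- w * ln 2) * sin (y * ln 2)). ring. }
  repeat apply real_analytic_plus; try apply real_analytic_mult; auto;
    try apply real_analytic_scal_exp.
  now apply alt_sum_cpow_analytic.
- intros u Hu. rewrite eta_right by exact Hu. ring.
Qed.

(** The lines off the axis are let tend to it; both sides are continuous in the
    vertical direction. *)
Lemma eta_on_axis (x : R) : -2 < x -> x <> 1 -> eta_re x 0 = alt_sum (cpow x 0).
Proof.
intros Hx Hx1.
set (f := fun y => eta_re x y - alt_sum (cpow x y)).
enough (f 0 = 0) by (unfold f in *; lra).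
assert (Hc : continuous f 0).
{ destruct (zeta_continuous_vertical x Hx1) as [HR HI].
  unfold f, eta_re. apply @continuous_minus; [|now apply alt_sum_cpow_continuous].
  apply @continuous_minus; apply @continuous_mult; try assumption;
    apply continuous_of_ex_derive; unfold cpow, spow; auto_derive; trivial. }
assert (Hl : is_lim_seq (fun n => f (/ (INR n + 1))) (f 0)).
{ apply is_lim_seq_continuous; [now apply continuity_pt_filterlim|].
  apply is_lim_seq_inv_infty.
  apply is_lim_seq_plus with p_infty 1; [apply is_lim_seq_INR|apply is_lim_seq_const|reflexivity]. }
apply is_lim_seq_unique in Hl.
rewrite (Lim_seq_ext _ (fun _ => 0)), Lim_seq_const in Hl; [now injection Hl|].
intros n. unfold f. rewrite eta_off_axis; [ring| |exact Hx].
apply Rinv_neq_0_compat. pose proof (pos_INR n); lra.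
Qed.

End Zeta.

(** * The derivative of zeta at -1 *)

Lemma ln_shift_lim (j : R) : 0 < j ->
  is_lim_seq (fun n => (2 * INR (S n) + j) * (ln (2 * INR (S n) + j) - ln (2 * INR (S n)))) j.
Proof.
intros Hj.
apply is_lim_seq_le_le with (u := fun _ => j) (w := fun n => j + j ^ 2 / 2 * / INR (S n)).
- intros n. pose proof (lt_0_INR (S n) ltac:(lia)) as Hn. set (N := INR (S n)) in *.
  split.
  + pose proof (ln_le_sub_1 (2 * N / (2 * N + j))
      ltac:(apply Rdiv_lt_0_compat; lra)) as H.
    rewrite ln_div in H by lra.
    apply Rle_trans with ((2 * N + j) * (1 - 2 * N / (2 * N + j))); [right; field; lra|].
    apply Rmult_le_compat_l; lra.
  + pose proof (ln_le_sub_1 ((2 * N + j) / (2 * N))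
      ltac:(apply Rdiv_lt_0_compat; lra)) as H.
    rewrite ln_div in H by lra.
    apply Rle_trans with ((2 * N + j) * ((2 * N + j) / (2 * N) - 1)); [|right; field; lra].
    apply Rmult_le_compat_l; lra.
- apply is_lim_seq_const.
- evar_last.
  + apply is_lim_seq_plus'; [apply is_lim_seq_const|].
    apply is_lim_seq_mult'; [apply is_lim_seq_const|].
    apply is_lim_seq_inv_infty. apply (is_lim_seq_incr_1 INR), is_lim_seq_INR.
  + apply f_equal; ring.
Qed.

Definition t_ln_sum (n : nat) : R := sum_n_m (fun v => INR v * ln (INR v)) 1 n.

Lemma t_ln_sum_S (n : nat) :
  t_ln_sum (S n) = t_ln_sum n + INR (S n) * ln (INR (S n)).
Proof. unfold t_ln_sum. now rewrite sum_n_Sm by lia. Qed.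

Lemma t_ln_sum_shift (N : nat) :
  sum_n (fun i => - (INR (S i) * ln (INR (S i)))) N = - t_ln_sum (S N).
Proof.
eqR. induction N as [|N IH].
- rewrite sum_O. unfold t_ln_sum. rewrite sum_n_n. reflexivity.
- rewrite sum_n_succ, IH, (t_ln_sum_S (S N)). ring.
Qed.

Lemma t_ln_sum_double (N : nat) :
  sum_n (fun i => - (2 * INR (S i) * ln (2 * INR (S i)))) N
  = - (2 * t_ln_sum (S N) + ln 2 * (INR (S N) * (INR (S N) + 1))).
Proof.
eqR. induction N as [|N IH].
- rewrite sum_O. unfold t_ln_sum. rewrite sum_n_n. simpl. rewrite ln_mult by lra. ring.
- rewrite sum_n_succ, IH, (t_ln_sum_S (S N)).
  rewrite ln_mult by (try lra; apply lt_0_INR; lia).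
  rewrite (S_INR (S N)). ring.
Qed.

(** The alternating sum of [v ln v] up to [2N] is [4 S(N) - S(2N)] plus explicit
    terms, where [S] is the sum of [v ln v]; so Glaisher's limit enters [4 - 1]
    times, and the boundary terms of Euler's transformation cancel the growth. *)
Lemma alt_sum_neg_t_ln (l : R) : is_lim_seq (fun n => glaisher_seq (S n)) l ->
  alt_sum (ptrig (-1) 0 1 ((-1) ^ 1) 0) = 3 * l - ln 2 / 3.
Proof.
intros Hl.
assert (Eg : forall t, 1 <= t -> ptrig (-1) 0 1 ((-1) ^ 1) 0 t = - (t * ln t)).
{ intros t Ht. unfold ptrig. rewrite Rmult_0_l, cos_0, sin_0.
  replace (- -1 * ln t) with (ln t) by ring. rewrite exp_ln by lra. simpl. field. }
rewrite (alt_sum_ext _ _ Eg). set (g := fun t => - (t * ln t)).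
assert (Hex : ex_series (fun n => (-1) ^ n * diff3 g (INR n + 1))).
{ apply ex_series_ext with
    (fun n => (-1) ^ n * diff3 (ptrig (-1) 0 1 ((-1) ^ 1) 0) (INR n + 1)).
  - intros n. unfold diff3. pose proof (pos_INR n). rewrite !Eg by lra. reflexivity.
  - apply ptrig_ex_series; [lra| |]; simpl; rewrite ?Rmult_1_r, ?Rabs_R0, ?Rabs_Ropp, ?Rabs_R1; try lra.
    rewrite Rabs_left; lra. }
pose proof (alt_sum_lim g Hex) as H1.
set (w := fun M => sum_n (fun i => (-1) ^ i * g (INR i + 1)) M
    - (-1) ^ M * euler_bd g (INR M + 2)).
(* indices from 0 to [2N+1]: an even number of terms, as [alt_sum_split] needs *)
assert (H2 : is_lim_seq (fun N => w (2 * N + 1)%nat) (alt_sum g)).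
{ apply (is_lim_seq_subseq w _ (fun N => (2 * N + 1)%nat)); [|exact H1].
  apply eventually_subseq; intros; lia. }
assert (H3 : is_lim_seq (fun N => w (2 * N + 1)%nat)
   (4 * l - l - ln 2 / 3 + / 4
    + - 7 / 8 * 1 + / 2 * 2 + - / 8 * 3)).
{ set (P := fun j N => (2 * INR (S N) + j) * (ln (2 * INR (S N) + j) - ln (2 * INR (S N)))).
  apply is_lim_seq_ext with (fun N => 4 * glaisher_seq (S N) - glaisher_seq (S (2 * N + 1))
    - ln 2 / 3 + / 4 + - 7 / 8 * P 1 N + / 2 * P 2 N + - / 8 * P 3 N).
  { intros N. unfold w. rewrite alt_sum_split.
    change (sum_n (fun i => g (INR (S i))) (2 * N + 1)) with
      (sum_n (fun i => - (INR (S i) * ln (INR (S i)))) (2 * N + 1)).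
    change (sum_n (fun i => g (2 * INR (S i))) N) with
      (sum_n (fun i => - (2 * INR (S i) * ln (2 * INR (S i)))) N).
    rewrite t_ln_sum_shift, t_ln_sum_double.
    replace (2 * N + 1)%nat with (S (2 * N)) at 3 by lia. rewrite pow_1_odd.
    unfold glaisher_seq. fold (t_ln_sum (S N)) (t_ln_sum (S (2 * N + 1))).
    assert (E2 : INR (S (2 * N + 1)) = 2 * INR (S N)).
    { rewrite !S_INR, plus_INR, mult_INR; simpl; ring. }
    assert (E3 : INR (2 * N + 1) + 2 = 2 * INR (S N) + 1).
    { rewrite <- E2, (S_INR (2 * N + 1)). ring. }
    rewrite E2, E3. pose proof (lt_0_INR (S N) ltac:(lia)) as Hn.
    unfold P, euler_bd, g. set (n := INR (S N)) in *.
    replace (2 * n + 1 + 1) with (2 * n + 2) by ring.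
    replace (2 * n + 1 + 2) with (2 * n + 3) by ring.
    rewrite (ln_mult 2 n) by lra. field. }
  do 4 (apply is_lim_seq_plus';
    [|first [apply is_lim_seq_const
            |apply is_lim_seq_mult'; [apply is_lim_seq_const|apply ln_shift_lim; lra]]]).
  apply is_lim_seq_minus'; [|apply is_lim_seq_const].
  apply is_lim_seq_minus'.
  - apply is_lim_seq_mult'; [apply is_lim_seq_const|exact Hl].
  - apply (is_lim_seq_subseq (fun n => glaisher_seq (S n)) l (fun N => (2 * N + 1)%nat));
      [|exact Hl].
    apply eventually_subseq; intros; lia. }
apply is_lim_seq_unique in H2. apply is_lim_seq_unique in H3.
rewrite H2 in H3. injection H3 as E. lra.
Qed.

(** Both sides of [(1 - 2^(1-s)) zeta(s) = alt_sum] are expanded to first order at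
    [-1]: the values give [zeta(-1) = -1/12], and then the derivatives give
    [zeta'(-1)]. *)
Lemma zeta_derive_minus_1 (zeta : C -> C) (Hzeta : is_riemann_zeta zeta) (l : R) :
  is_lim_seq (fun n => glaisher_seq (S n)) l ->
  Re (C_derive zeta (RtoC (-1))) = - l.
Proof.
intros Hl. set (D := Re (C_derive zeta (RtoC (-1)))).
set (z := Re (zeta (-1, 0))).
assert (E : forall x, -2 < x -> x <> 1 ->
  (1 - 2 * exp (- x * ln 2)) * Re (zeta (x, 0)) = alt_sum (cpow x 0)).
{ intros x Hx Hx1. rewrite <- (eta_on_axis zeta Hzeta) by assumption.
  unfold eta_re, cpow, spow. rewrite !Rmult_0_l, cos_0, sin_0. ring. }
assert (E2 : exp (- -1 * ln 2) = 2).
{ replace (- -1 * ln 2) with (ln 2) by ring. apply exp_ln; lra. }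
assert (Hz : -3 * z = / 4).
{ replace (-3 * z) with ((1 - 2 * exp (- -1 * ln 2)) * Re (zeta (-1, 0)))
    by (rewrite E2; unfold z; ring).
  rewrite E by lra. (* the regularised value of 1 - 2 + 3 - ..., with no third differences *)
  rewrite (alt_sum_ext _ (fun t => t)).
  - unfold alt_sum, euler_bd. rewrite (Series_ext _ (fun _ => 0 * 0)).
    + rewrite Series_scal_l. field.
    + intros n. unfold diff3. ring.
  - intros t Ht. unfold cpow. rewrite Rmult_0_l, cos_0.
    replace (- -1 * ln t) with (ln t) by ring. rewrite exp_ln by lra. ring. }
assert (H1 : is_derive (fun x => alt_sum (cpow x 0)) (-1) (4 * ln 2 * z - 3 * D)).
{ apply is_derive_ext_loc with
    (fun x => (1 - 2 * exp (- x * ln 2)) * Re (zeta (x, 0))).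
  - exists (mkposreal 1 Rlt_0_1). intros x Hx.
    change (Rabs (x - -1) < 1) in Hx. apply Rabs_lt_between in Hx. apply E; lra.
  - evar_last.
    + apply (is_derive_mult (fun x => 1 - 2 * exp (- x * ln 2)) (fun x => Re (zeta (x, 0)))).
      * auto_derive; [trivial|reflexivity].
      * apply (zeta_derive_at zeta Hzeta); lra.
      * intros; apply Rmult_comm.
    + rewrite E2. fold D z. unfold plus, mult; simpl. eqR. unfold z. ring. }
assert (H2 : is_derive (fun x => alt_sum (cpow x 0)) (-1)
   (alt_sum (ptrig (-1) 0 1 ((-1) ^ 1) 0))).
{ apply (real_analytic_derive (fun x => alt_sum (cpow x 0)) (-1) (/ 2)
    (fun m => alt_sum (ptrig (-1) 0 m ((-1) ^ m) 0))); [lra|].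
  intros h Hh. apply alt_sum_cpow_pseries; lra. }
rewrite (alt_sum_neg_t_ln l Hl) in H2.
apply is_derive_unique in H1. apply is_derive_unique in H2. rewrite H1 in H2.
replace z with (- / 12) in H2 by lra. lra.
Qed.

(** * Enveloping series *)

(** The remainders of [f] after the terms of index [2, ..., m-1] alternate in sign
    with [m], the first one being negative. *)
Definition enveloped (t : nat -> R) (f : R) : Prop :=
  forall m, (2 <= m)%nat -> 0 < (-1) ^ (m - 1) * (f - sum_n_m t 2 (m - 1)).

(** Consecutive remainders have opposite signs, and their difference is the
    omitted term. *)
Lemma enveloped_remainder (t : nat -> R) (f : R) (m : nat) :
  enveloped t f -> (2 <= m)%nat ->
  exists theta, 0 < theta < 1 /\ f = sum_n_m t 2 (m - 1) + theta * t m.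
Proof.
intros H Hm. pose proof (H m Hm) as H1. pose proof (H (S m) ltac:(lia)) as H2.
destruct m as [|p]; [lia|].
replace (S (S p) - 1)%nat with (S p) in H2 by lia.
replace (S p - 1)%nat with p in * by lia.
rewrite sum_n_Sm in H2 by lia.
set (s := sum_n_m t 2 p : R) in *.
change (0 < -1 * (-1) ^ p * (f - (s + t (S p)))) in H2.
set (r := f - s) in *.
assert (Hd : (-1) ^ p * r < (-1) ^ p * t (S p)) by (unfold r in *; lra).
assert (Ht : t (S p) <> 0) by (intros E; rewrite E in Hd; lra).
assert (Hsg : (-1) ^ p <> 0) by (apply pow_nonzero; lra).
assert (E : r / t (S p) = ((-1) ^ p * r) / ((-1) ^ p * t (S p))) by (field; auto).
exists (r / t (S p)). split.
- rewrite E. split.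
  + apply Rdiv_lt_0_compat; lra.
  + apply Rmult_lt_reg_r with ((-1) ^ p * t (S p)); [lra|].
    unfold Rdiv. rewrite Rmult_assoc, Rinv_l; lra.
- unfold r. field. exact Ht.
Qed.

Lemma enveloped_first (t : nat -> R) (f : R) : enveloped t f -> t 2%nat < f < 0.
Proof.
intros H. pose proof (H 2%nat ltac:(lia)) as H1. pose proof (H 3%nat ltac:(lia)) as H2.
simpl Nat.sub in H1, H2. rewrite sum_n_m_zero in H1 by lia. rewrite sum_n_n in H2.
unfold zero in H1. simpl in H1, H2. lra.
Qed.

Lemma is_series_sum_n_m (t : nat -> nat -> R) (T : nat -> R) (p : nat) :
  (forall j, (2 <= j)%nat -> is_series (t j) (T j)) ->
  is_series (fun v => sum_n_m (fun j => t j v) 2 p) (sum_n_m T 2 p).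
Proof.
intros H.
assert (H0 : forall q, (q < 2)%nat ->
  is_series (fun v => sum_n_m (fun j => t j v) 2 q) (sum_n_m T 2 q)).
{ intros q Hq. rewrite sum_n_m_zero by lia.
  apply is_series_ext with (fun _ => 0).
  - intros n. rewrite sum_n_m_zero by lia. reflexivity.
  - exact is_series_null. }
destruct p as [|[|p]]; [apply H0; lia|apply H0; lia|].
induction p as [|p IH].
- rewrite sum_n_n. apply is_series_ext with (t 2%nat).
  + intros n. now rewrite sum_n_n.
  + apply H; lia.
- rewrite sum_n_Sm by lia.
  apply is_series_ext with
    (fun v => sum_n_m (fun j => t j v) 2 (S (S p)) + t (S (S (S p))) v).
  + intros v. rewrite (sum_n_Sm _ 2 (S (S p))) by lia. reflexivity.
  + apply is_series_Rplus; [exact IH|apply H; lia].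
Qed.

(** Termwise summation preserves enveloping because the remainders have a common
    sign; the first two also give the absolute convergence. *)
Lemma enveloped_Series (t : nat -> nat -> R) (T : nat -> R) (f : nat -> R) :
  (forall v, enveloped (fun j => t j v) (f v)) ->
  (forall j, (2 <= j)%nat -> is_series (t j) (T j)) ->
  ex_series f /\ enveloped T (Series f).
Proof.
intros He Ht.
assert (Hf : ex_series f).
{ apply (ex_series_le (V := R_CompleteNormedModule)) with (fun v => -1 * t 2%nat v).
  - intros v. unfold norm; simpl; unfold abs; simpl.
    pose proof (enveloped_first _ _ (He v)). rewrite Rabs_left; lra.
  - exists (-1 * T 2%nat). apply is_series_Rmult, Ht; lia. }
split; [exact Hf|]. intros m Hm.
assert (Hs : is_series (fun v => (-1) ^ (m - 1) * (f v + -1 * sum_n_m (fun j => t j v) 2 (m - 1)))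
   ((-1) ^ (m - 1) * (Series f + -1 * sum_n_m T 2 (m - 1)))).
{ apply is_series_Rmult, is_series_Rplus; [now apply Series_correct|].
  apply is_series_Rmult, is_series_sum_n_m, Ht. }
replace (Series f - sum_n_m T 2 (m - 1)) with (Series f + -1 * sum_n_m T 2 (m - 1)) by ring.
rewrite <- (is_series_unique _ _ Hs).
apply Series_pos; [eexists; exact Hs|]. intros v.
specialize (He v m Hm).
replace (f v + -1 * sum_n_m (fun j => t j v) 2 (m - 1))
  with (f v - sum_n_m (fun j => t j v) 2 (m - 1)) by ring.
exact He.
Qed.

(** * Logarithms of products *)

Lemma prod_from1_exp (h : nat -> R) (n : nat) :
  prod_from1 (fun i => exp (h i)) n = exp (sum_n_m h 1 n).
Proof.
induction n as [|n IH].
- rewrite sum_n_m_zero by lia. simpl. symmetry; apply exp_0.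
- simpl. rewrite IH, <- exp_plus, sum_n_Sm by lia. reflexivity.
Qed.

Lemma prod_from1_ext (f g : nat -> R) (n : nat) :
  (forall i, f i = g i) -> prod_from1 f n = prod_from1 g n.
Proof. intros H; induction n as [|n IH]; simpl; [reflexivity|]. now rewrite IH, H. Qed.

(** Asymptotic equivalence is read on logarithms. *)
Lemma asymp_equiv_exp (f g : nat -> R) :
  is_lim_seq (fun n => f (S n) - g (S n)) 0 -> forall F G,
  (forall n, (1 <= n)%nat -> F n = exp (f n)) ->
  (forall n, (1 <= n)%nat -> G n = exp (g n)) -> asymp_equiv F G.
Proof.
intros H F G HF HG. unfold asymp_equiv. apply is_lim_seq_incr_1.
apply is_lim_seq_ext with (fun n => exp (f (S n) - g (S n))).
{ intros n. rewrite HF, HG by lia. unfold Rminus. rewrite exp_plus, exp_Ropp. reflexivity. }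
rewrite <- exp_0. apply is_lim_seq_continuous; [|exact H].
apply derivable_continuous_pt, derivable_pt_exp.
Qed.

Lemma is_lim_seq_sum_n_m (a : nat -> R) :
  ex_series (fun v => a (S v)) ->
  is_lim_seq (fun n => sum_n_m a 1 (S n)) (Series (fun v => a (S v))).
Proof.
intros H. apply Series_correct in H.
apply is_lim_seq_ext with (sum_n (fun v => a (S v))); [|exact H].
intros n. unfold sum_n. apply sum_n_m_S.
Qed.

(** * The constants F_k *)

Section Constants.
Variable zeta : C -> C.
Variable B : nat -> R.
Hypothesis Hzeta : is_riemann_zeta zeta.
Hypothesis HB : is_bernoulli_numbers B.

Lemma zeta_odd_series (j : nat) : (2 <= j)%nat ->
  is_series (fun v => / INR (S v) ^ (2 * j - 1)) (zeta_odd zeta j).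
Proof.
intros Hj.
assert (Hx : 1 < 2 * INR j - 1).
{ apply le_INR in Hj. simpl in Hj. lra. }
destruct (zeta_dirichlet zeta Hzeta (2 * INR j - 1) 0 Hx) as [H _].
revert H. apply is_series_ext. intros v. eqR. unfold cpow.
rewrite Rmult_0_l, cos_0, Rmult_1_r.
replace (- (2 * INR j - 1) * ln (INR (S v))) with (- (INR (2 * j - 1) * ln (INR (S v)))).
2: { rewrite minus_INR, mult_INR by lia. simpl. ring. }
rewrite exp_Ropp, <- exp_pow_INR, exp_ln by (apply lt_0_INR; lia). reflexivity.
Qed.

(** Binet's function without its leading term, whose sum over multiples diverges
    and is responsible for Euler's constant. *)
Definition binet_tail (n : nat) : R := binet n - / (12 * INR n).

Lemma binet_tail_enveloped (n : nat) : (1 <= n)%nat ->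
  enveloped (fun j => stirling_coef B j / INR n ^ (2 * j - 1)) (binet_tail n).
Proof.
intros Hn m Hm. pose proof (binet_envelope B HB (m - 1) n Hn) as H.
unfold stirling_sum in H. rewrite sum_Sn_m in H by lia.
pose proof (stirling_sum_1 B HB (INR n)) as E1. unfold stirling_sum in E1.
rewrite sum_n_n in E1. rewrite E1 in H.
unfold binet_tail. unfold plus in H; simpl in H.
match type of H with 0 < ?a * (?b - (?c + ?d)) =>
  replace (a * (b - (c + d))) with (a * (b - c - d)) in H by ring end.
exact H.
Qed.

Definition binet_tail_sum (k : nat) : R := Series (fun v => binet_tail (k * S v)).

Definition logF_coef (j : nat) : R := stirling_coef B j * zeta_odd zeta j.

Lemma binet_tail_sum_enveloped (k : nat) : (1 <= k)%nat ->
  ex_series (fun v => binet_tail (k * S v)) /\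
  enveloped (fun j => logF_coef j / INR k ^ (2 * j - 1)) (binet_tail_sum k).
Proof.
intros Hk. apply (enveloped_Series
  (fun j v => stirling_coef B j / INR (k * S v) ^ (2 * j - 1))).
- intros v. apply binet_tail_enveloped. nia.
- intros j Hj.
  pose proof (is_series_Rmult (stirling_coef B j / INR k ^ (2 * j - 1)) _ _
    (zeta_odd_series j Hj)) as H.
  replace (logF_coef j / INR k ^ (2 * j - 1)) with
    (stirling_coef B j / INR k ^ (2 * j - 1) * zeta_odd zeta j)
    by (unfold logF_coef, Rdiv; ring).
  revert H. apply is_series_ext. intros v. eqR.
  rewrite mult_INR, Rpow_mult_distr. unfold Rdiv. rewrite Rinv_mult. ring.
Qed.

Lemma binet_tail_sum_Series_enveloped :
  ex_series (fun v => binet_tail_sum (S v)) /\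
  enveloped (fun j => logF_coef j * zeta_odd zeta j) (Series (fun v => binet_tail_sum (S v))).
Proof.
apply (enveloped_Series (fun j v => logF_coef j / INR (S v) ^ (2 * j - 1))).
- intros v. apply binet_tail_sum_enveloped; lia.
- intros j Hj. apply is_series_Rmult. now apply zeta_odd_series.
Qed.

(** By enveloping, [binet_tail_sum k] is at most of the order [k^(-3)]. *)
Lemma binet_tail_sum_lim : is_lim_seq (fun k => INR k * binet_tail_sum k) 0.
Proof.
set (c := - logF_coef 2).
apply is_lim_seq_incr_1. apply is_lim_seq_abs_0.
apply is_lim_seq_le_le with (u := fun _ => 0) (w := fun k => c * / INR (S k)).
- intros k. split; [apply Rabs_pos|].
  destruct (binet_tail_sum_enveloped (S k) ltac:(lia)) as [_ He].
  apply enveloped_first in He. change (2 * 2 - 1)%nat with 3%nat in He.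
  pose proof (lt_0_INR (S k) ltac:(lia)) as Hk0.
  assert (Hk : 1 <= INR (S k)) by (rewrite S_INR; pose proof (pos_INR k); lra).
  set (x := INR (S k)) in *.
  rewrite Rabs_left by (apply Rmult_pos_neg; lra).
  assert (E : - (x * (logF_coef 2 / x ^ 3)) = c / x ^ 2) by (unfold c; field; lra).
  assert (Hc : 0 < c / x ^ 2).
  { rewrite <- E. apply Ropp_0_gt_lt_contravar, Rmult_pos_neg; lra. }
  assert (Hx2 : 0 < / x ^ 2) by (apply Rinv_0_lt_compat, pow_lt; lra).
  assert (Hc0 : 0 < c).
  { apply Rmult_lt_reg_r with (/ x ^ 2); [exact Hx2|]. unfold Rdiv in Hc. lra. }
  apply Rle_trans with (c / x ^ 2).
  + rewrite <- E. apply Ropp_le_contravar, Rmult_le_compat_l; lra.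
  + apply Rmult_le_compat_l; [lra|]. apply Rinv_le_contravar; [lra|]. simpl. nra.
- apply is_lim_seq_const.
- evar_last.
  + apply is_lim_seq_mult'; [apply is_lim_seq_const|].
    apply is_lim_seq_inv_infty. apply (is_lim_seq_incr_1 INR), is_lim_seq_INR.
  + apply f_equal; ring.
Qed.

Definition logF (k : nat) : R := euler_gamma / (12 * INR k) + binet_tail_sum k.

Lemma logF_scaled_lim : is_lim_seq (fun k => INR k * logF k) (euler_gamma / 12).
Proof.
apply is_lim_seq_incr_1.
apply is_lim_seq_ext with (fun k => euler_gamma / 12 + INR (S k) * binet_tail_sum (S k)).
{ intros k. unfold logF. pose proof (lt_0_INR (S k) ltac:(lia)). field. lra. }
evar_last.
- apply is_lim_seq_plus'; [apply is_lim_seq_const|].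
  apply (is_lim_seq_incr_1 (fun k => INR k * binet_tail_sum k)), binet_tail_sum_lim.
- apply f_equal; ring.
Qed.

Lemma logF_lim : is_lim_seq logF 0.
Proof.
apply is_lim_seq_incr_1.
apply is_lim_seq_ext with (fun k => INR (S k) * logF (S k) * / INR (S k)).
{ intros k. field. apply not_0_INR; lia. }
evar_last.
- apply is_lim_seq_mult'.
  + apply (is_lim_seq_incr_1 (fun k => INR k * logF k)), logF_scaled_lim.
  + apply is_lim_seq_inv_infty. apply (is_lim_seq_incr_1 INR), is_lim_seq_INR.
- apply f_equal; ring.
Qed.

(** Stirling's formula summed over the multiples of [k]. *)
Lemma log_fact_sum (k n : nat) : (1 <= k)%nat ->
  sum_n_m (fun v => ln (INR (fact (k * v)))) 1 n
  = sum_n_m (fun v => binet_tail (k * v)) 1 n + harmonic n / (12 * INR k)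
    + INR n / 2 * ln (2 * PI) + INR k * t_ln_sum n
    + INR k * ln (INR k) * (INR n * (INR n + 1) / 2)
    + (ln (INR (fact n)) + INR n * ln (INR k)) / 2
    - INR k * (INR n * (INR n + 1) / 2).
Proof.
intros Hk. pose proof (lt_0_INR k ltac:(lia)) as Hk0. eqR.
unfold harmonic, t_ln_sum. induction n as [|n IH].
- rewrite !sum_n_m_zero by lia. unfold zero; simpl. rewrite ln_1. field. lra.
- rewrite !(sum_n_Sm _ 1 n) by lia. rewrite IH. change (@plus _) with Rplus.
  pose proof (lt_0_INR (S n) ltac:(lia)) as Hn0.
  rewrite fact_simpl, mult_INR, (ln_mult (INR (S n))) by (assumption || apply INR_fact_lt_0).
  unfold binet_tail at 3, binet, stirling_log.
  rewrite mult_INR, (ln_mult (INR k)) by assumption.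
  rewrite S_INR in *. field. lra.
Qed.

Definition log_fact_product (k n : nat) : R :=
  sum_n_m (fun v => ln (INR (fact (k * v)))) 1 n.

(** The logarithm of the claimed equivalent, [1/12 + l] standing for the logarithm
    of the Glaisher-Kinkelin constant. *)
Definition log_equivalent (k : nat) (l : R) (n : nat) : R :=
  logF k + INR k * (1 / 12 + l) + 1 / 4 * ln (2 * PI)
  + INR k / 2 * (INR n * (INR n + 1)) * (ln (INR k) + ln (INR n) - 3 / 2)
  + INR n / 2 * (ln (2 * PI) + ln (INR k) + (INR k / 2 - 1) + ln (INR n))
  + (1 / 4 + INR k / 12 + 1 / (12 * INR k)) * ln (INR n).

(** The difference is a combination of four sequences: the errors in the limits of
    Glaisher, Stirling and Euler, and the tail of the series defining [logF]. *)
Lemma product_log_asymptotics (k : nat) (l : R) : (1 <= k)%nat ->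
  is_lim_seq (fun n => glaisher_seq (S n)) l ->
  is_lim_seq (fun n => log_fact_product k (S n) - log_equivalent k l (S n)) 0.
Proof.
intros Hk Hl. pose proof (lt_0_INR k ltac:(lia)) as Hk0.
unfold log_fact_product, log_equivalent.
destruct (binet_tail_sum_enveloped k Hk) as [Hex _].
apply is_lim_seq_ext with (fun m =>
  INR k * (glaisher_seq (S m) - l) + / 2 * (stirling_log (S m) - ln (2 * PI) / 2)
  + / (12 * INR k) * (harmonic (S m) - ln (INR (S m)) - euler_gamma)
  + (sum_n_m (fun v => binet_tail (k * v)) 1 (S m) - binet_tail_sum k)).
{ intros m. rewrite log_fact_sum by exact Hk. set (n := S m).
  unfold glaisher_seq, stirling_log, logF. fold (t_ln_sum n). field. lra. }
evar_last.
- apply is_lim_seq_plus'; [apply is_lim_seq_plus'; [apply is_lim_seq_plus'|]|].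
  + apply is_lim_seq_mult'; [apply is_lim_seq_const|].
    apply is_lim_seq_minus'; [exact Hl|apply is_lim_seq_const].
  + apply is_lim_seq_mult'; [apply is_lim_seq_const|].
    apply is_lim_seq_minus'; [now apply (stirling_log_lim B)|apply is_lim_seq_const].
  + apply is_lim_seq_mult'; [apply is_lim_seq_const|].
    apply is_lim_seq_minus'; [|apply is_lim_seq_const].
    apply (is_lim_seq_incr_1 (fun n => harmonic n - ln (INR n))), harmonic_lim.
  + apply is_lim_seq_minus'; [|apply is_lim_seq_const].
    apply (is_lim_seq_sum_n_m (fun v => binet_tail (k * v))). exact Hex.
- apply f_equal. unfold binet_tail_sum. ring.
Qed.

(** The leading terms of the [ln F_k] form a second harmonic sum. *)
Lemma harmonic_sum_n_m (c : R) (n : nat) :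
  sum_n_m (fun k => c / (12 * INR k)) 1 n = c / 12 * harmonic n.
Proof.
eqR. unfold harmonic. induction n as [|n IH].
- rewrite !sum_n_m_zero by lia. unfold zero; simpl. ring.
- rewrite !(sum_n_Sm _ 1 n) by lia. change (@plus _) with Rplus. rewrite IH.
  field. apply not_0_INR; lia.
Qed.

Lemma logF_sum (n : nat) :
  sum_n_m logF 1 n = euler_gamma / 12 * harmonic n + sum_n_m binet_tail_sum 1 n.
Proof.
eqR. rewrite <- harmonic_sum_n_m.
exact (sum_n_m_plus (fun k => euler_gamma / (12 * INR k)) binet_tail_sum 1 n).
Qed.

End Constants.

Theorem theorem3p1 (zeta : C -> C) (B : nat -> R)
    (Hzeta : is_riemann_zeta zeta) (HB : is_bernoulli_numbers B) :
  exists F : nat -> R,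
    (forall k : nat, (1 <= k)%nat ->
       0 < F k /\
       asymp_equiv
         (fun n => prod_from1 (fun nu => INR (fact (k * nu))) n)
         (fun n =>
            F k * glaisher zeta ^ k * Rpower (2 * PI) (1 / 4)
            * Rpower (INR k * INR n / exp (3 / 2))
                     (INR k / 2 * (INR n * (INR n + 1)))
            * Rpower (2 * PI * INR k * exp (INR k / 2 - 1) * INR n)
                     (INR n / 2)
            * Rpower (INR n) (1 / 4 + INR k / 12 + 1 / (12 * INR k)))) /\
    divergent_series (fun k : nat => (1 <= k)%nat)
      (fun k => ln (F k) - euler_gamma / (12 * INR k))
      2
      (fun j k => B (2 * j)%nat * zeta_odd zeta j
                  / (2 * INR j * (2 * INR j - 1) * INR k ^ (2 * j - 1))) /\
    is_lim_seq F 1 /\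
    is_lim_seq (fun k => F k ^ k) (exp (euler_gamma / 12)) /\
    exists Finf : R,
      0 < Finf /\
      asymp_equiv (prod_from1 F)
        (fun n => Finf * Rpower (INR n) (euler_gamma / 12)) /\
      divergent_series (fun _ : unit => True)
        (fun _ => ln Finf - euler_gamma ^ 2 / 12)
        2
        (fun j _ => B (2 * j)%nat * zeta_odd zeta j ^ 2
                    / (2 * INR j * (2 * INR j - 1))).
Proof.
pose proof PI_RGT_0 as HPI.
destruct (glaisher_seq_cv B HB) as [l Hl].
assert (HA : glaisher zeta = exp (1 / 12 + l)).
{ unfold glaisher. rewrite (zeta_derive_minus_1 zeta Hzeta l Hl). f_equal; ring. }
exists (fun k => exp (logF k)).
split; [|split; [|split; [|split]]].
- intros k Hk. split; [apply exp_pos|].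
  pose proof (lt_0_INR k ltac:(lia)) as Hk0.
  apply (asymp_equiv_exp (log_fact_product k) (log_equivalent k l)
    (product_log_asymptotics zeta B Hzeta HB k l Hk Hl)).
  + intros n _. unfold log_fact_product. rewrite <- prod_from1_exp. apply prod_from1_ext.
    intros i. symmetry. apply exp_ln, INR_fact_lt_0.
  + intros n Hn. pose proof (lt_0_INR n ltac:(lia)) as Hn0.
    rewrite HA, exp_pow_INR. unfold Rpower, log_equivalent. rewrite <- !exp_plus. f_equal.
    pose proof (exp_pos (INR k / 2 - 1)) as He.
    assert (0 < INR k * INR n) by now apply Rmult_lt_0_compat.
    assert (0 < 2 * PI * INR k) by (apply Rmult_lt_0_compat; lra).
    assert (0 < 2 * PI * INR k * exp (INR k / 2 - 1)) by now apply Rmult_lt_0_compat.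
    rewrite ln_div, (ln_mult (INR k) (INR n)), ln_exp by (assumption || apply exp_pos).
    rewrite (ln_mult (2 * PI * INR k * exp (INR k / 2 - 1))),
      (ln_mult (2 * PI * INR k)), ln_exp, (ln_mult (2 * PI)) by (assumption || lra).
    reflexivity.
- exists 2%nat. intros m Hm k Hk. rewrite ln_exp.
  destruct (binet_tail_sum_enveloped zeta B Hzeta HB k Hk) as [_ He].
  destruct (enveloped_remainder _ _ m He Hm) as [theta [Ht E]].
  exists theta. split; [exact Ht|].
  pose proof (lt_0_INR k ltac:(lia)) as Hk0.
  assert (Ec : forall j, (2 <= j)%nat -> logF_coef zeta B j / INR k ^ (2 * j - 1)
    = B (2 * j)%nat * zeta_odd zeta j
      / (2 * INR j * (2 * INR j - 1) * INR k ^ (2 * j - 1))).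
  { intros j Hj. apply le_INR in Hj. simpl in Hj.
    assert (INR k ^ (2 * j - 1) <> 0) by (apply pow_nonzero; lra).
    unfold logF_coef, stirling_coef. field. repeat split; try assumption; lra. }
  rewrite <- Ec by exact Hm.
  rewrite (sum_n_m_ext_loc _ (fun j => logF_coef zeta B j / INR k ^ (2 * j - 1))).
  + rewrite <- E. unfold logF. ring.
  + intros j Hj. symmetry. apply Ec; lia.
- rewrite <- exp_0. apply is_lim_seq_exp, (logF_lim zeta B Hzeta HB).
- apply is_lim_seq_ext with (fun k => exp (INR k * logF k)).
  { intros k. symmetry. apply exp_pow_INR. }
  apply is_lim_seq_exp, (logF_scaled_lim zeta B Hzeta HB).
- destruct (binet_tail_sum_Series_enveloped zeta B Hzeta HB) as [Hex He].
  set (S0 := Series (fun v => binet_tail_sum (S v))) in *.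
  exists (exp (euler_gamma ^ 2 / 12 + S0)). split; [apply exp_pos|]. split.
  + apply (asymp_equiv_exp (fun n => sum_n_m logF 1 n)
      (fun n => euler_gamma ^ 2 / 12 + S0 + euler_gamma / 12 * ln (INR n))).
    * apply is_lim_seq_ext with (fun n =>
        euler_gamma / 12 * (harmonic (S n) - ln (INR (S n)) - euler_gamma)
        + (sum_n_m binet_tail_sum 1 (S n) - S0)).
      { intros n. rewrite logF_sum. field. }
      evar_last.
      { apply is_lim_seq_plus'.
        - apply is_lim_seq_mult'; [apply is_lim_seq_const|].
          apply is_lim_seq_minus'; [|apply is_lim_seq_const].
          apply (is_lim_seq_incr_1 (fun n => harmonic n - ln (INR n))), harmonic_lim.
        - apply is_lim_seq_minus'; [|apply is_lim_seq_const].
          apply is_lim_seq_sum_n_m, Hex. }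
      apply f_equal. unfold S0. ring.
    * intros n _. apply prod_from1_exp.
    * intros n _. unfold Rpower. now rewrite <- exp_plus.
  + exists 2%nat. intros m Hm _ _. rewrite ln_exp.
    destruct (enveloped_remainder _ _ m He Hm) as [theta [Ht E]].
    exists theta. split; [exact Ht|].
    assert (Ec : forall j, (2 <= j)%nat -> logF_coef zeta B j * zeta_odd zeta j
      = B (2 * j)%nat * zeta_odd zeta j ^ 2 / (2 * INR j * (2 * INR j - 1))).
    { intros j Hj. apply le_INR in Hj. simpl in Hj.
      unfold logF_coef, stirling_coef. field. split; lra. }
    rewrite <- Ec by exact Hm.
    rewrite (sum_n_m_ext_loc _ (fun j => logF_coef zeta B j * zeta_odd zeta j)).
    * rewrite <- E. ring.
    * intros j Hj. symmetry. apply Ec; lia.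
Qed.
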